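(* Let $A \subseteq \mathbb{R}^2$ be finite and generic. Then for every integer $1 \leq k \leq \#A-1$, the order-$k$ Delaunay triangulation of $A$ has the local angle property.
   Context: A finite set $A\subseteq\mathbb{R}^2$ is generic if no three of its points are collinear and no four are cocircular; $\#A$ is its cardinality and $\mathrm{conv}\,A$ its convex hull. A triangulation of a finite set $S\subseteq\mathbb{R}^2$ is an edge-to-edge subdivision of $\mathrm{conv}\,S$ into triangles whose vertices are points of $S$ (not necessarily all of them); it is identified with its set of triangles. For a set $I$ of $k$ points, $[I]=\frac1k\sum_{x\in I}x$; we write $[Ia]=[I\cup\{a\}]$ for $a \notin I$, $[Iab]=[I\cup\{a,b\}]$, etc. For $1\le k\le \#A-1$ let $A^{(k)}=\{[I]: I\subseteq A,\ \#I=k\}$. A level-$k$ hypertriangulation of $A$ is a (possibly partial) triangulation of the point set $A^{(k)}$ such that every edge with endpoints $[I]$ and $[J]$ satisfies $\#(I\cap J)=k-1$. Each vertex carries one label $I$: if a point of $A^{(k)}$ is the average of several $k$-subsets, a hypertriangulation using it as a vertex uses only one of these labels. A triangle with vertices $[I],[J],[K]$ is black if $\#(I\cap J\cap K)=k-2$ (so its vertices are $[Xab],[Xac],[Xbc]$ with $\#X=k-2$) and white if $\#(I\cap J\cap K)=k-1$ (so its vertices are $[Ya],[Yb],[Yc]$ with $\#Y=k-1$). Order-$k$ Delaunay triangulation of $A$: the level-$k$ hypertriangulation of $A$ consisting of (i) all black triangles with vertices $[Xab],[Xac],[Xbc]$, where $a,b,c\in A$, $X\subseteq A$ is the set of points of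 $A$ inside the circumcircle of $abc$, and $\#X=k-2$; and (ii) all white triangles with vertices $[Ya],[Yb],[Yc]$, where $a,b,c\in A$, $Y\subseteq A$ is the set of points of $A$ inside the circumcircle of $abc$, and $\#Y=k-1$. Local angle property: a level-$k$ hypertriangulation of $A$ has the local angle property if (ww) for every edge shared by two white triangles, the sum of the two angles opposite the edge is at most $\pi$; (bb) for every edge shared by two black triangles, the sum of the two angles opposite the edge is at least $\pi$; (bw) for every edge shared by a black triangle and a white triangle, the angle opposite the edge in the black triangle is bigger than the angle opposite the edge in the white triangle. *)

(* Defs.v *)
From mathcomp Require Import all_boot all_order all_algebra finmap.
From mathcomp Require Import all_classical all_reals all_analysis.
From mathcomp Require Import ring lra.

Set Implicit Arguments.
Unset Strict Implicit.
Unset Printing Implicit Defensive.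

Import Order.TTheory GRing.Theory Num.Theory.

Local Open Scope classical_set_scope.
Local Open Scope fset_scope.
Local Open Scope ring_scope.

Notation plane R := 'rV[R]_2.

(* MathComp-Analysis equips 'rV[R]_2 with the sup norm, so the Euclidean
   structure is introduced here. *)
Definition dot (R : realType) (u v : plane R) : R :=
  \sum_(i < 2) u 0 i * v 0 i.

Definition dist (R : realType) (x y : plane R) : R :=
  Num.sqrt (dot (x - y) (x - y)).

Definition angle (R : realType) (p a b : plane R) : R :=
  acos (dot (a - p) (b - p) / (dist a p * dist b p)).

Definition collinear (R : realType) (S : {fset plane R}) : Prop :=
  exists (n : plane R) (c : R), n != 0 /\ forall x, x \in S -> dot n x = c.

Definition cocircular (R : realType) (S : {fset plane R}) : Prop :=
  exists (o : plane R) (r : R), 0 < r /\ forall x, x \in S -> dist x o = r.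

Definition generic (R : realType) (A : {fset plane R}) : Prop :=
  (forall B : {fset plane R}, B `<=` A -> #|` B| = 3%N -> ~ collinear B) /\
  (forall B : {fset plane R}, B `<=` A -> #|` B| = 4%N -> ~ cocircular B).

Definition conv (R : realType) (S : {fset plane R}) : set (plane R) :=
  [set y | exists w : plane R -> R,
     [/\ forall x, x \in S -> 0 <= w x,
         \sum_(x <- S) w x = 1 &
         y = \sum_(x <- S) w x *: x] ].

(* A set of triangles, each given by its set of vertices.  A collinear set S
   spans no triangle, and its only triangulation is the empty one. *)
Definition triangulation (R : realType) (S : {fset plane R})
    (D : set {fset plane R}) : Prop :=
  [/\ forall t, D t -> [/\ t `<=` S, #|` t| = 3%N & ~ collinear t],
      forall t t', D t -> D t' ->
        (conv t `&` conv t' = conv (t `&` t')%fset)%classic &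
      ~ collinear S -> (\bigcup_(t in D) conv t = conv S)%classic].

Definition bary (R : realType) (I : {fset plane R}) : plane R :=
  (#|` I|%:R)^-1 *: \sum_(x <- I) x.

Definition ksubsets (R : realType) (A : {fset plane R}) (k : nat) :
    {fset {fset plane R}} :=
  [fset I in fpowerset A | #|` I| == k].

Definition level (R : realType) (A : {fset plane R}) (k : nat) :
    {fset plane R} :=
  [fset bary I | I in ksubsets A k].

(* Triangles of a hypertriangulation are recorded by the labels of their
   vertices; this is the underlying triangle. *)
Definition realize (R : realType) (t : {fset {fset plane R}}) :
    {fset plane R} :=
  [fset bary I | I in t].

Definition is_hypertriangulation (R : realType) (A : {fset plane R}) (k : nat)
    (T : set {fset {fset plane R}}) : Prop :=
  [/\ forall t I, T t -> I \in t -> I \in ksubsets A k,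
      forall t t' I J, T t -> T t' -> I \in t -> J \in t' ->
        bary I = bary J -> I = J,
      triangulation (level A k) (@realize R @` T)%classic &
      forall t I J, T t -> I \in t -> J \in t -> I != J ->
        (#|` I `&` J| + 1 = k)%N].

Record hypertriangulation (R : realType) (A : {fset plane R}) (k : nat) :=
  Hypertriangulation {
    triangles :> set {fset {fset plane R}};
    trianglesP : is_hypertriangulation A k triangles }.

(* The colour conditions are written #(I∩J∩K) + 2 = k and #(I∩J∩K) + 1 = k
   because subtraction on nat is truncated. *)
Definition black (R : realType) (k : nat) (t : {fset {fset plane R}}) : Prop :=
  exists I J K : {fset plane R},
    t = [fset I; J; K] /\ (#|` I `&` J `&` K| + 2 = k)%N.

Definition white (R : realType) (k : nat) (t : {fset {fset plane R}}) : Prop :=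
  exists I J K : {fset plane R},
    t = [fset I; J; K] /\ (#|` I `&` J `&` K| + 1 = k)%N.

Definition in_circumcircle (R : realType) (a b c x : plane R) : Prop :=
  exists (o : plane R) (r : R),
    [/\ dist a o = r, dist b o = r, dist c o = r & dist x o < r].

Definition inside (R : realType) (A : {fset plane R}) (a b c : plane R) :
    {fset plane R} :=
  [fset x in A | `[< in_circumcircle a b c x >] ].

Definition delaunay_black (R : realType) (A : {fset plane R}) (k : nat) :
    set {fset {fset plane R}} :=
  [set t | exists a b c : plane R,
     [/\ [fset a; b; c] `<=` A, #|` [fset a; b; c]| = 3%N,
         (#|` inside A a b c| + 2 = k)%N &
         t = [fset inside A a b c `|` [fset a; b];
                   inside A a b c `|` [fset a; c];
                   inside A a b c `|` [fset b; c]] ] ].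

Definition delaunay_white (R : realType) (A : {fset plane R}) (k : nat) :
    set {fset {fset plane R}} :=
  [set t | exists a b c : plane R,
     [/\ [fset a; b; c] `<=` A, #|` [fset a; b; c]| = 3%N,
         (#|` inside A a b c| + 1 = k)%N &
         t = [fset inside A a b c `|` [fset a];
                   inside A a b c `|` [fset b];
                   inside A a b c `|` [fset c]] ] ].

Definition delaunay_triangles (R : realType) (A : {fset plane R}) (k : nat) :
    set {fset {fset plane R}} :=
  (delaunay_black A k `|` delaunay_white A k)%classic.

(* The definition of the order-k Delaunay triangulation presupposes that the
   triangles above form a level-k hypertriangulation; this is proved here, by
   lifting each k-subset I to height hgt I over bary I: every triangle carries
   an affine function lying below all these heights and meeting them exactly
   at its own labels. *)
Section Dot.
Variable R : realType.
Implicit Types (u v w x y z o n : plane R) (a c r s : R) (I J A X : {fset plane R}).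

Lemma dotE u v : dot u v = u 0 0 * v 0 0 + u 0 1 * v 0 1.
Proof.
by rewrite /dot !big_ord_recl big_ord0 addr0; congr (_ * _ + _ * _); congr (_ _ _);
  apply/val_inj.
Qed.

Lemma point_eq u v : u 0 0 = v 0 0 -> u 0 1 = v 0 1 -> u = v.
Proof.
move=> e0 e1; apply/rowP => -[[|[|//]] i].
- by rewrite (_ : Ordinal i = 0)//; apply/val_inj.
- by rewrite (_ : Ordinal i = 1)//; apply/val_inj.
Qed.

Lemma dotC u v : dot u v = dot v u.
Proof. by rewrite !dotE; ring. Qed.

Lemma dotDr u v w : dot u (v + w) = dot u v + dot u w.
Proof. by rewrite !dotE !mxE; ring. Qed.

Lemma dotNr u v : dot u (- v) = - dot u v.
Proof. by rewrite !dotE !mxE; ring. Qed.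

Lemma dotBr u v w : dot u (v - w) = dot u v - dot u w.
Proof. by rewrite dotDr dotNr. Qed.

Lemma dotZr u a v : dot u (a *: v) = a * dot u v.
Proof. by rewrite !dotE !mxE; ring. Qed.

Lemma dotZl u a v : dot (a *: u) v = a * dot u v.
Proof. by rewrite !dotE !mxE; ring. Qed.

Lemma dot0r u : dot u 0 = 0.
Proof. by rewrite !dotE !mxE; ring. Qed.

Lemma dot_sumr (K : Type) (s : seq K) (P : pred K) (F : K -> plane R) u :
  dot u (\sum_(i <- s | P i) F i) = \sum_(i <- s | P i) dot u (F i).
Proof. exact: (big_morph (dot u) (dotDr u) (dot0r u)). Qed.

Lemma dot_ge0 u : 0 <= dot u u.
Proof. by rewrite dotE addr_ge0 // -expr2 sqr_ge0. Qed.

Lemma dot_eq0 u : (dot u u == 0) = (u == 0).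
Proof.
apply/eqP/eqP => [|->]; last by rewrite dot0r.
rewrite dotE => h; apply: point_eq; rewrite !mxE; nra.
Qed.

(* power of x with respect to the circle of centre o and squared radius s *)
Definition pw o s x : R := dot (x - o) (x - o) - s.

Lemma pwE o s x : pw o s x = dot x x - 2 * dot o x + (dot o o - s).
Proof. by rewrite /pw !dotE !mxE; ring. Qed.

Definition hgt I : R := \sum_(x <- I) dot x x.

Lemma sum_baryE I : (0 < #|` I|)%N -> \sum_(x <- I) x = #|` I|%:R *: bary I.
Proof. by move=> h; rewrite /bary scalerA divff ?scale1r// pnatr_eq0 -lt0n. Qed.

Lemma card_sum I : \sum_(x <- I) (1 : R) = #|` I|%:R.
Proof. by rewrite big_const_seq count_predT iter_addr_0. Qed.

Lemma sum_pw o s I : (0 < #|` I|)%N ->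
  \sum_(x <- I) pw o s x =
    hgt I - #|` I|%:R * (2 * dot o (bary I)) + #|` I|%:R * (dot o o - s).
Proof.
move=> h; under eq_bigr do rewrite pwE.
rewrite big_split /= sumrB -mulr_sumr -dot_sumr sum_baryE// dotZr.
rewrite -[X in _ + X](_ : #|` I|%:R * (dot o o - s) = _) ?/hgt; first by ring.
by rewrite -card_sum mulr_suml; apply: eq_bigr => x _; rewrite mul1r.
Qed.

Lemma sum_subset (V : nmodType) (F : plane R -> V) I A : I `<=` A ->
  \sum_(x <- I) F x = \sum_(x <- A | x \in I) F x.
Proof.
move=> IA; rewrite -[RHS]big_filter; apply: perm_big; apply: uniq_perm.
- exact: fset_uniq.
- exact/filter_uniq/fset_uniq.
- move=> x; rewrite mem_filter; apply/idP/andP => [h|[]//]; split=> //.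
  exact: (fsubsetP IA).
Qed.

Lemma min_sum (f : plane R -> R) A I X : I `<=` A ->
  X = [fset x in A | f x < 0] ->
  \sum_(x <- X) f x <= \sum_(x <- I) f x /\
  (\sum_(x <- X) f x = \sum_(x <- I) f x <->
    X `<=` I /\ forall x, x \in I -> f x <= 0).
Proof.
move=> IA defX.
have XA : X `<=` A by rewrite defX; apply/fsubsetP => x; rewrite !inE => /andP[].
have inX x : x \in A -> (x \in X) = (f x < 0) by move=> xA; rewrite defX !inE xA.
pose g x := (if x \in I then f x else 0) - (if x \in X then f x else 0).
have gE : \sum_(x <- I) f x - \sum_(x <- X) f x = \sum_(x <- A) g x.
  by rewrite (sum_subset _ IA) (sum_subset _ XA) big_mkcond [X in _ - X]big_mkcond
    -sumrB.
have g0 x : x \in A -> 0 <= g x.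
  by move=> xA; rewrite /g (inX _ xA); case: ifP; case: ltP; lra.
have s0 : 0 <= \sum_(x <- A) g x.
  by rewrite big_seq; apply: sumr_ge0 => x; exact: g0.
split; first by lra.
split => [e|[XI If]].
  have /eqP : \sum_(x <- A) g x = 0 by lra.
  rewrite big_seq psumr_eq0; last by move=> x; exact: g0.
  move=> /allP z.
  have {}z x : x \in A -> g x = 0 by move=> xA; have := z x xA; rewrite xA => /eqP.
  split.
    apply/fsubsetP => x xX; have xA := fsubsetP XA x xX.
    have := z x xA; rewrite /g xX; case: ifP => // _.
    by move: xX; rewrite inX//; lra.
  move=> x xI; have xA := fsubsetP IA x xI.
  have := z x xA; rewrite /g xI inX//; case: ltP; lra.
suff : \sum_(x <- A) g x = 0 by lra.
rewrite big_seq big1// => x xA; rewrite /g inX//.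
case: ltP => fx.
  by rewrite (fsubsetP XI) ?subrr// inX.
case: ifP => [xI|_]; last by rewrite subrr.
by have := If x xI; lra.
Qed.

End Dot.

Section Combinatorics.
Variable K : choiceType.
Implicit Types (a b c x : K) (X I : {fset K}).

Lemma card3P a b c :
  #|` [fset a; b; c]| = 3%N <-> [/\ a != b, a != c & b != c].
Proof.
rewrite fsetUC cardfsU1 cardfs2 !inE negb_or (eq_sym c a) (eq_sym c b).
by case: (a != b); case: (a != c); case: (b != c); split => // -[].
Qed.

Lemma between1 a b c X I :
  X `<=` I -> I `<=` X `|` [fset a; b; c] -> (#|` I| = #|` X| + 1)%N ->
  I \in [fset X `|` [fset a]; X `|` [fset b]; X `|` [fset c]].
Proof.
move=> XI IXO cI.
have /eqP/cardfs1P[w wE] : #|` I `\` X| = 1%N.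
  by rewrite cardfsD (fsetIidPr XI) cI addnC addnK.
have IE : I = X `|` [fset w].
  apply/fsetP => x; rewrite -wE !inE; case xX: (x \in X) => //=.
  by rewrite (fsubsetP XI).
have /fsetP/(_ w) := wE; rewrite !inE eqxx => /andP[wX wI].
have := fsubsetP IXO w wI; rewrite !inE (negbTE wX) /=.
by case/orP => [/orP[]|] /eqP wE'; rewrite IE wE' eqxx ?orbT.
Qed.

Lemma between2 a b c X I :
  a \notin X -> b \notin X -> c \notin X -> [/\ a != b, a != c & b != c] ->
  X `<=` I -> I `<=` X `|` [fset a; b; c] -> (#|` I| = #|` X| + 2)%N ->
  I \in [fset X `|` [fset a; b]; X `|` [fset a; c]; X `|` [fset b; c]].
Proof.
move=> aX bX cX d XI IXO cI.
have cO : #|` X `|` [fset a; b; c]| = (#|` X| + 3)%N.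
  rewrite cardfsU (_ : X `&` [fset a; b; c] = fset0) ?cardfs0 ?subn0.
    by have [_ ->] := card3P a b c.
  apply/fsetP => x; rewrite !inE; apply/negbTE/negP => /andP[xX].
  by case/orP => [/orP[]|] /eqP xE; move: xX; rewrite xE ?(negbTE aX) ?(negbTE bX)
    ?(negbTE cX).
have /eqP/cardfs1P[w wE] : #|` (X `|` [fset a; b; c]) `\` I| = 1%N.
  by rewrite cardfsD (fsetIidPr IXO) cO cI subnDl.
have IE x : (x \in I) = ((x \in X) || (x \in [fset a; b; c])) && (x != w).
  have <- : (x \in (X `|` [fset a; b; c]) `\` I) = (x == w) by rewrite wE inE.
  rewrite in_fsetD negb_and negbK -in_fsetU.
  case xI: (x \in I) => /=; first by rewrite (fsubsetP IXO).
  by rewrite andbN.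
have : w \in (X `|` [fset a; b; c]) `\` I by rewrite wE inE.
rewrite !inE => /andP[wI].
have wX : w \notin X by apply: contra wI; exact: (fsubsetP XI).
rewrite (negbTE wX) /=.
have Xw x : x \in X -> x != w by move=> xX; apply: contraNneq wX => <-.
case: d => ab ac bc.
have sol p q r : p != r -> q != r -> w = r ->
    [fset a; b; c] = [fset p; q; r] -> I = X `|` [fset p; q].
  move=> pr qr wr E; apply/fsetP => x; rewrite IE E wr !inE.
  case xX: (x \in X) => /=; first by rewrite -wr Xw.
  case: (eqVneq x r) => [->|_]; last by rewrite orbF andbT.
  by rewrite andbF eq_sym (negbTE pr) eq_sym (negbTE qr).
case/orP => [/orP[]|] /eqP wr.
- rewrite (_ : I = X `|` [fset b; c]) ?eqxx ?orbT//.
  apply: (sol b c a) => //; try by rewrite eq_sym.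
  by apply/fsetP => x; rewrite !inE; do !case: eqP => // _.
- rewrite (_ : I = X `|` [fset a; c]) ?eqxx ?orbT//.
  apply: (sol a c b) => //; try by rewrite eq_sym.
  by apply/fsetP => x; rewrite !inE; do !case: eqP => // _.
- rewrite (_ : I = X `|` [fset a; b]) ?eqxx ?orbT//.
  exact: (sol a b c).
Qed.
End Combinatorics.

Section Circles.
Variable R : realType.
Implicit Types (u v w x y z o n : plane R) (r s e : R) (I J A X : {fset plane R}).
Implicit Types (a b c : plane R).

Definition cross u v : R := u 0 0 * v 0 1 - u 0 1 * v 0 0.

Lemma perp_cross n u v : n != 0 -> dot n u = 0 -> dot n v = 0 -> cross u v = 0.
Proof.
rewrite -dot_eq0 !dotE /cross => n0 hu hv.
have h0 : (n 0 0 * n 0 0 + n 0 1 * n 0 1) * (u 0 0 * v 0 1 - u 0 1 * v 0 0) = 0.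
  rewrite (_ : _ * _ = (n 0 0 * u 0 0 + n 0 1 * u 0 1) * (n 0 0 * v 0 1 - n 0 1 * v 0 0)
    + (n 0 0 * v 0 0 + n 0 1 * v 0 1) * (n 0 1 * u 0 0 - n 0 0 * u 0 1)); last by ring.
  by rewrite hu hv !mul0r addr0.
by move/eqP: h0; rewrite mulf_eq0 (negbTE n0) /= => /eqP.
Qed.

Definition det3 a b c := cross (b - a) (c - a).

Lemma det3E a b c : det3 a b c = (b 0 0 - a 0 0) * (c 0 1 - a 0 1) -
  (b 0 1 - a 0 1) * (c 0 0 - a 0 0).
Proof. by rewrite /det3 /cross !mxE. Qed.

Definition perp u : plane R := \row_i (if i == 0 then - u 0 1 else u 0 0).
Lemma perp0 u : perp u 0 0 = - u 0 1. Proof. by rewrite mxE. Qed.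
Lemma perp1 u : perp u 0 1 = u 0 0. Proof. by rewrite mxE. Qed.

Lemma dot_perp u v : dot (perp u) v = cross u v.
Proof. by rewrite dotE perp0 perp1 /cross; ring. Qed.

Lemma perp_neq0 u : u != 0 -> perp u != 0.
Proof.
apply: contra => /eqP h; apply/eqP/point_eq; rewrite mxE.
  by rewrite -perp1 h mxE.
by apply/oppr_inj; rewrite -perp0 h !mxE oppr0.
Qed.

Lemma collinear_det3 a b c (S : {fset plane R}) : collinear S ->
  a \in S -> b \in S -> c \in S -> det3 a b c = 0.
Proof.
move=> [n [m [n0 h]]] aS bS cS; apply: (perp_cross n0); rewrite dotBr !h//; ring.
Qed.

Lemma det3_collinear a b c : a != b -> det3 a b c = 0 -> collinear [fset a; b; c].
Proof.
move=> ab h; exists (perp (b - a)), (dot (perp (b - a)) a); split.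
  by rewrite perp_neq0// subr_eq0 eq_sym.
move=> x; rewrite !inE => /orP[/orP[]|] /eqP -> //; apply/eqP; rewrite -subr_eq0.
  by rewrite -dotBr dot_perp /cross; apply/eqP; ring.
by rewrite -dotBr dot_perp -/(det3 a b c) h.
Qed.

Lemma dist_sqr x y : dist x y ^+ 2 = dot (x - y) (x - y).
Proof. by rewrite sqr_sqrtr// dot_ge0. Qed.

Lemma dist_ge0 x y : 0 <= dist x y.
Proof. exact: sqrtr_ge0. Qed.

Lemma dist_pw x o r : dist x o = r -> pw o (r ^+ 2) x = 0.
Proof. by move=> <-; rewrite /pw dist_sqr subrr. Qed.

Lemma pw_dist x o r : 0 <= r -> (pw o (r ^+ 2) x == 0) = (dist x o == r).
Proof.
move=> r0; rewrite /pw -dist_sqr subr_eq0 eqrXn2//; exact: dist_ge0.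
Qed.

Lemma pw_lt x o r : 0 <= r -> (pw o (r ^+ 2) x < 0) = (dist x o < r).
Proof.
by move=> r0; rewrite /pw -dist_sqr subr_lt0 ltr_pXn2r// nnegrE// dist_ge0.
Qed.

Lemma circ_exists a b c : det3 a b c != 0 ->
  exists o r, [/\ dist a o = r, dist b o = r & dist c o = r].
Proof.
rewrite /det3; set u := b - a; set v := c - a => D0.
pose w : plane R := \row_i (if i == 0 then (dot u u * v 0 1 - dot v v * u 0 1) / (2 * cross u v)
  else (dot v v * u 0 0 - dot u u * v 0 0) / (2 * cross u v)).
have w0 : w 0 0 = (dot u u * v 0 1 - dot v v * u 0 1) / (2 * cross u v) by rewrite mxE.
have w1 : w 0 1 = (dot v v * u 0 0 - dot u u * v 0 0) / (2 * cross u v) by rewrite mxE.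
have hu : 2 * dot w u = dot u u.
  rewrite [dot w u]dotE w0 w1; move: D0; rewrite !dotE /cross => D0; field.
  by rewrite D0.
have hv : 2 * dot w v = dot v v.
  rewrite [dot w v]dotE w0 w1; move: D0; rewrite !dotE /cross => D0; field.
  by rewrite D0.
exists (a + w), (dist a (a + w)); split=> //.
  rewrite /dist; congr Num.sqrt; move: hu; rewrite /u !dotE !mxE; nra.
rewrite /dist; congr Num.sqrt; move: hv; rewrite /v !dotE !mxE; nra.
Qed.

Lemma center_uniq a b c o o' s s' : det3 a b c != 0 ->
  pw o s a = 0 -> pw o s b = 0 -> pw o s c = 0 ->
  pw o' s' a = 0 -> pw o' s' b = 0 -> pw o' s' c = 0 -> o = o' /\ s = s'.
Proof.
move=> D0 a1 b1 c1 a2 b2 c2.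
have oo : o = o'.
  apply/eqP; rewrite -subr_eq0; apply: contraNT D0 => D0; apply/eqP.
  apply: (perp_cross D0); move: a1 b1 c1 a2 b2 c2; rewrite /pw !dotE !mxE; nra.
split=> //; move: a1 a2; rewrite oo /pw => a1 a2; lra.
Qed.

Lemma circ_data A a b c : generic A -> [fset a; b; c] `<=` A ->
  #|` [fset a; b; c]| = 3%N -> exists o s,
  [/\ inside A a b c = [fset x in A | pw o s x < 0],
      forall x, x \in A -> (pw o s x == 0) = (x \in [fset a; b; c]),
      det3 a b c != 0 & 0 < s].
Proof.
move=> [g3 g4] sub c3; have [ab ac bc] := (card3P a b c).1 c3.
have D0 : det3 a b c != 0.
  by apply/eqP => D0; apply: (g3 _ sub c3); exact: det3_collinear.
have [ o [r [ha hb hc]]] := circ_exists D0.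
have r0 : 0 <= r by rewrite -ha dist_ge0.
have rp : 0 < r.
  rewrite lt_neqAle r0 andbT; apply: contraNneq ab => rE.
  have /eqP := dist_pw ha; have /eqP := dist_pw hb; rewrite -rE /pw expr0n/= !subr0.
  by rewrite !dot_eq0 !subr_eq0 => /eqP -> /eqP ->.
exists o, (r ^+ 2); split=> //; last by rewrite exprn_gt0.
  apply/fsetP => x; rewrite !inE; congr andb; rewrite pw_lt//.
  apply/asboolP/idP => [[ o' [r' [ha' hb' hc' hx]]]|hx]; last by exists o, r.
  have [oE rE] := center_uniq D0 (dist_pw ha) (dist_pw hb) (dist_pw hc)
     (dist_pw ha') (dist_pw hb') (dist_pw hc').
  have r0' : 0 <= r' by rewrite -ha' dist_ge0.
  by rewrite oE; move: hx; rewrite -!pw_lt// rE.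
move=> x xA; rewrite pw_dist//; apply/idP/idP => [/eqP hx|]; last first.
  by rewrite !inE => /orP[/orP[]|] /eqP ->; rewrite ?ha ?hb ?hc.
apply/negPn/negP => xO; apply: (g4 (x |` [fset a; b; c])).
- by rewrite fsubUset sub andbT; apply/fsubsetP => z; rewrite inE => /eqP ->.
- by rewrite cardfsU1 xO c3.
exists o, r; split=> // z; rewrite in_fset1U => /orP[/eqP ->//|].
by rewrite !inE => /orP[/orP[]|] /eqP ->; rewrite ?ha ?hb ?hc.
Qed.

(* affine minorants of the lifted point configuration *)
Definition supp A k (t : {fset {fset plane R}}) u e :=
  forall I, I \in ksubsets A k -> dot u (bary I) + e <= hgt I /\
    (dot u (bary I) + e = hgt I <-> I \in t).

Lemma ksubsetsP A k I : reflect (I `<=` A /\ #|` I| = k) (I \in ksubsets A k).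
Proof.
by rewrite !inE /= fpowersetE; apply: (iffP andP) => -[h1 /eqP h2].
Qed.

Lemma delaunayP A k t : generic A -> delaunay_triangles A k t ->
  exists a b c o s X,
  [/\ [/\ a \in A, b \in A & c \in A],
      [/\ a != b, a != c, b != c & det3 a b c != 0],
      X = [fset x in A | pw o s x < 0],
      forall x, x \in A -> (pw o s x == 0) = (x \in [fset a; b; c]) &
   ((#|` X| + 2 = k)%N /\ t = [fset X `|` [fset a; b]; X `|` [fset a; c]; X `|` [fset b; c]]) \/
   ((#|` X| + 1 = k)%N /\ t = [fset X `|` [fset a]; X `|` [fset b]; X `|` [fset c]])].
Proof.
move=> gA [] [a [b [c [sub c3 kE tE]]]]; have [ o [s [XE OE D0 _]]] := circ_data gA sub c3;
  have [ab ac bc] := (card3P a b c).1 c3; exists a, b, c, o, s, (inside A a b c); split=> //.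
- by split; apply: (fsubsetP sub); rewrite !inE eqxx ?orbT.
- by left.
- by split; apply: (fsubsetP sub); rewrite !inE eqxx ?orbT.
- by right.
Qed.

Lemma delaunay_mem A k t : generic A -> delaunay_triangles A k t ->
  exists o s, forall I, I \in ksubsets A k ->
   (I \in t <-> [fset x in A | pw o s x < 0] `<=` I /\ forall x, x \in I -> pw o s x <= 0).
Proof.
move=> gA /(delaunayP gA)[a [b [c [ o [s [X [[aA bA cA] [ab ac bc D0] XE OE tE]]]]]]].
exists o, s => I /ksubsetsP[IA Ik]; rewrite -XE.
have Oa x : x \in [fset a; b; c] -> x \notin X /\ pw o s x <= 0.
  move=> xO; have xA : x \in A.
    by move: xO; rewrite !inE => /orP[/orP[]|] /eqP ->.
  move: xO; rewrite -OE// => /eqP px; rewrite px lexx; split=> //.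
  by rewrite XE !inE px ltxx andbF.
have Xa x : x \in X -> pw o s x <= 0.
  by rewrite XE !inE => /andP[_]; exact: ltW.
have [aX ap] : a \notin X /\ pw o s a <= 0 by apply: Oa; rewrite !inE eqxx.
have [bX bp] : b \notin X /\ pw o s b <= 0 by apply: Oa; rewrite !inE eqxx orbT.
have [cX cp] : c \notin X /\ pw o s c <= 0 by apply: Oa; rewrite !inE eqxx orbT.
split=> [It|[XI If]].
  case: tE => -[kE tE]; move: It; rewrite tE !inE => /orP[/orP[]|] /eqP ->;
    by split=> [|x]; rewrite ?fsubsetUl// !inE => /orP[/Xa//|]; try case/orP; move/eqP ->.
have IXO : I `<=` X `|` [fset a; b; c].
  apply/fsubsetP => x xI; have xA := fsubsetP IA x xI.
  rewrite in_fsetU XE -OE// !inE xA /= orbC -le_eqVlt; exact: If.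
have cIX : forall m, (#|` X| + m = k)%N -> (#|` I| = #|` X| + m)%N by move=> m kE; rewrite Ik.
case: tE => -[kE ->]; [apply: between2 => //; exact: cIX|apply: between1 => //; exact: cIX].
Qed.

Lemma delaunay_supp A k t : generic A -> (0 < k)%N -> delaunay_triangles A k t ->
  exists u e, supp A k t u e.
Proof.
move=> gA k0 dt; have [ o [s h]] := delaunay_mem gA dt.
set X := [fset x in A | pw o s x < 0] in h.
exists ((k%:R * 2) *: o), (\sum_(x <- X) pw o s x - k%:R * (dot o o - s)).
move=> I Ik; have [IA cI] := ksubsetsP _ _ _ Ik.
have [le e] := min_sum IA (erefl X).
have cI0 : (0 < #|` I|)%N by rewrite cI.
have E := sum_pw o s cI0; rewrite cI in E; rewrite dotZl.
split; first by lra.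
rewrite h// -/X; rewrite -e; split=> ?; lra.
Qed.

End Circles.

Section Structure.
Variable R : realType.
Implicit Types (u v w x y z n p q r : plane R) (s e : R) (I J K A X : {fset plane R}).
Implicit Types (a b c : plane R) (t : {fset {fset plane R}}).

Lemma collinear2 p q r : p = q -> collinear [fset p; q; r].
Proof.
move=> <-; exists (if p == r then \row__ 1 else perp (r - p)).
exists (dot (if p == r then \row__ 1 else perp (r - p)) p); split.
  case: (eqVneq p r) => [_|pr]; last by rewrite perp_neq0// subr_eq0 eq_sym.
  by apply/eqP => /rowP/(_ 0)/eqP; rewrite !mxE oner_eq0.
move=> x; rewrite !inE => /orP[/orP[]|] /eqP -> //.
case: (eqVneq p r) => [->//|pr]; apply/eqP; rewrite -subr_eq0.
by rewrite -dotBr dot_perp /cross; apply/eqP; ring.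
Qed.

Lemma collinear3 p q r (S : {fset plane R}) :
  ~ collinear S -> S = [fset p; q; r] -> [/\ p != q, p != r & q != r].
Proof.
move=> nc SE; split; apply/eqP => e; apply: nc; rewrite SE.
- exact: collinear2.
- rewrite (_ : [fset p; q; r] = [fset p; r; q]); first exact: collinear2.
  by apply/fsetP => x; rewrite !inE orbAC.
- rewrite (_ : [fset p; q; r] = [fset q; r; p]); first exact: collinear2.
  by apply/fsetP => x; rewrite !inE; do !case: eqP => // _.
Qed.

Lemma realize3 I J K : realize [fset I; J; K] = [fset bary I; bary J; bary K].
Proof.
apply/fsetP => x; rewrite !inE; apply/imfsetP/idP => /= [[L]|].
  by rewrite !inE => /orP[/orP[]|] /eqP -> ->; rewrite eqxx ?orbT.
move=> /orP[/orP[]|] /eqP ->; [exists I|exists J|exists K] => //;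
  by rewrite !inE eqxx ?orbT.
Qed.

Lemma card_U1 X a : a \notin X -> #|` X `|` [fset a]| = (#|` X| + 1)%N.
Proof. by move=> aX; rewrite fsetUC cardfsU1 aX addnC. Qed.

Lemma card_U2 X a b : a != b -> a \notin X -> b \notin X ->
   #|` X `|` [fset a; b]| = (#|` X| + 2)%N.
Proof.
move=> ab aX bX; rewrite fsetUA card_U1 ?card_U1 -?addnA//.
by rewrite !inE (negbTE bX) eq_sym.
Qed.

Lemma sum_U1 X a : a \notin X -> \sum_(x <- X `|` [fset a]) x = \sum_(x <- X) x + a.
Proof. by move=> aX; rewrite fsetUC big_fsetU1//= addrC. Qed.

Lemma sum_U2 X a b : a != b -> a \notin X -> b \notin X ->
  \sum_(x <- X `|` [fset a; b]) x = \sum_(x <- X) x + a + b.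
Proof.
move=> ab aX bX; rewrite fsetUA sum_U1 ?sum_U1//.
by rewrite !inE (negbTE bX) eq_sym.
Qed.

Lemma delaunayP2 A k t : generic A -> delaunay_triangles A k t ->
  exists a b c X,
  [/\ [/\ a \in A, b \in A & c \in A],
      [/\ a != b, a != c, b != c & det3 a b c != 0],
      X `<=` A, [/\ a \notin X, b \notin X & c \notin X] &
   ((#|` X| + 2 = k)%N /\ t = [fset X `|` [fset a; b]; X `|` [fset a; c]; X `|` [fset b; c]]) \/
   ((#|` X| + 1 = k)%N /\ t = [fset X `|` [fset a]; X `|` [fset b]; X `|` [fset c]])].
Proof.
move=> gA /(delaunayP gA)[a [b [c [ o [s [X [[aA bA cA] d XE OE tE]]]]]]].
have nX x : x \in A -> x \in [fset a; b; c] -> x \notin X.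
  by move=> xA; rewrite -OE// XE !inE => /eqP ->; rewrite ltxx andbF.
exists a, b, c, X; split=> //.
  by rewrite XE; apply/fsubsetP => x; rewrite !inE => /andP[].
by split; apply: nX => //; rewrite !inE eqxx ?orbT.
Qed.

Lemma delaunay_ksub A k t I : generic A -> delaunay_triangles A k t ->
  I \in t -> I \in ksubsets A k.
Proof.
move=> gA /(delaunayP2 gA)[a [b [c [X [[aA bA cA] [ab ac bc _] XA [aX bX cX] tE]]]]] It.
apply/ksubsetsP; case: tE => -[kE tE]; move: It; rewrite tE !inE => /orP[/orP[]|] /eqP ->;
  rewrite ?card_U2 ?card_U1//; split=> //; apply/fsubsetP => x;
  rewrite !inE => /orP[/(fsubsetP XA)//|]; try case/orP; by move/eqP ->.
Qed.

Lemma delaunay_edge A k t I J : generic A -> delaunay_triangles A k t ->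
  I \in t -> J \in t -> I != J -> (#|` I `&` J| + 1 = k)%N.
Proof.
move=> gA /(delaunayP2 gA)[a [b [c [X [[aA bA cA] [ab ac bc _] XA [aX bX cX] tE]]]]].
have S1 p q : p != q -> p \notin X -> q \notin X ->
    (X `|` [fset p]) `&` (X `|` [fset q]) = X.
  move=> pq pX qX; rewrite -fsetUIr (_ : [fset p] `&` [fset q] = fset0) ?fsetU0//.
  by apply/fsetP => x; rewrite !inE; case: eqP => // ->; rewrite (negbTE pq).
have S2 p q r D E : p != q -> p != r -> q != r -> p \notin X -> q \notin X -> r \notin X ->
    D = [fset p; q] -> E = [fset p; r] ->
    (#|` (X `|` D) `&` (X `|` E)| = #|` X| + 1)%N.
  move=> pq pr qr pX qX rX -> ->; rewrite -fsetUIr.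
  rewrite (_ : [fset p; q] `&` [fset p; r] = [fset p]) ?card_U1//.
  apply/fsetP => x; rewrite !inE; case: eqP => //= _.
  by case: eqP => //= ->; rewrite (negbTE qr).
have ba : b != a by rewrite eq_sym.
have ca : c != a by rewrite eq_sym.
have cb : c != b by rewrite eq_sym.
case: tE => -[kE ->]; rewrite !inE => /orP[/orP[]|] /eqP -> /orP[/orP[]|] /eqP -> => ne;
  rewrite ?eqxx// in ne *.
- by rewrite (S2 a b c)// -?addnA// fsetUC.
- by rewrite (S2 b a c)// -?addnA// fsetUC.
- by rewrite (S2 a c b)// -?addnA// fsetUC.
- by rewrite (S2 c a b)// -?addnA// fsetUC.
- by rewrite (S2 b c a)// -?addnA// fsetUC.
- by rewrite (S2 c b a)// -?addnA// fsetUC.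
all: by rewrite S1.
Qed.

Lemma delaunay_noncollinear A k t : generic A -> (0 < k)%N ->
  delaunay_triangles A k t -> ~ collinear (realize t).
Proof.
move=> gA k0 dt; have ks I := @delaunay_ksub A k t I gA dt.
have := dt => /(delaunayP2 gA)[a [b [c [X [[aA bA cA] [ab ac bc D0] XA [aX bX cX] tE]]]]].
move=> [n [m [n0 h]]]; move: D0; apply/negP/negPn/eqP.
have {}h I : I \in t -> dot n (\sum_(x <- I) x) = k%:R * m.
  move=> It; have [_ cI] := ksubsetsP _ _ _ (ks I It).
  rewrite sum_baryE cI// dotZr h//; exact: in_imfset.
suff [h1 h2] : dot n (b - a) = 0 /\ dot n (c - a) = 0 by exact: (perp_cross n0).
rewrite !dotBr.
case: tE => -[kE tE]; rewrite tE in h.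
  have := h (X `|` [fset a; b]); have := h (X `|` [fset a; c]); have := h (X `|` [fset b; c]).
  rewrite !sum_U2// !inE !eqxx ?orbT => /(_ isT) e1 /(_ isT) e2 /(_ isT) e3.
  by move: e1 e2 e3; rewrite !dotDr => e1 e2 e3; split; lra.
have := h (X `|` [fset a]); have := h (X `|` [fset b]); have := h (X `|` [fset c]).
rewrite !sum_U1// !inE !eqxx ?orbT => /(_ isT) e1 /(_ isT) e2 /(_ isT) e3.
by move: e1 e2 e3; rewrite !dotDr => e1 e2 e3; split; lra.
Qed.

Lemma delaunay_triple A k t : generic A -> delaunay_triangles A k t ->
  exists I J K, t = [fset I; J; K].
Proof.
move=> gA /(delaunayP2 gA)[a [b [c [X [_ _ _ _ [] [_ ->]]]]]]; by do 3 eexists.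
Qed.

Lemma delaunay_label A k t t' I J : generic A -> (0 < k)%N ->
  delaunay_triangles A k t -> delaunay_triangles A k t' -> I \in t -> J \in t' ->
  bary I = bary J -> I = J.
Proof.
move=> gA k0 dt dt' It Jt' e.
have kI := delaunay_ksub gA dt It; have kJ := delaunay_ksub gA dt' Jt'.
have [u [m h]] := delaunay_supp gA k0 dt; have [u' [m' h']] := delaunay_supp gA k0 dt'.
have [l1 [_ /(_ It) e1]] := h I kI; have [l2 e2] := h J kJ.
have [l3 _] := h' I kI; have [l4 [_ /(_ Jt') e4]] := h' J kJ.
have Jt : J \in t by apply/e2; rewrite e in l3 l1 e1; lra.
have := delaunay_noncollinear gA k0 dt.
have [I1 [I2 [I3 tE]]] := delaunay_triple gA dt; rewrite tE realize3 => nc.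
have [d1 d2 d3] := collinear3 nc erefl.
move: It Jt e; rewrite tE !inE => /orP[/orP[]|] /eqP -> /orP[/orP[]|] /eqP -> // /eqP;
  by rewrite ?(negbTE d1) ?(negbTE d2) ?(negbTE d3)//
    eq_sym ?(negbTE d1) ?(negbTE d2) ?(negbTE d3).
Qed.

Lemma conv_mono (S S' : {fset plane R}) : S `<=` S' -> (conv S `<=` conv S')%classic.
Proof.
move=> SS y [w [w0 w1 ->]]; exists (fun x => if x \in S then w x else 0); split.
- by move=> x _; case: ifP => // /w0.
- by rewrite -w1 [in RHS](sum_subset _ SS) [RHS]big_mkcond.
- rewrite [LHS](sum_subset _ SS) [LHS]big_mkcond; apply: eq_bigr => x _.
  by case: ifP => // _; rewrite scale0r.
Qed.

Lemma delaunay_conv A k t t' y : generic A -> (0 < k)%N ->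
  delaunay_triangles A k t -> delaunay_triangles A k t' ->
  conv (realize t) y -> conv (realize t') y -> conv (realize t `&` realize t') y.
Proof.
move=> gA k0 dt dt'.
have [u [m h]] := delaunay_supp gA k0 dt; have [u' [m' h']] := delaunay_supp gA k0 dt'.
have lem t1 t2 u1 m1 u2 m2 : supp A k t1 u1 m1 -> supp A k t2 u2 m2 ->
    delaunay_triangles A k t1 -> forall x, x \in realize t1 ->
    0 <= (dot u1 x + m1) - (dot u2 x + m2) /\
    ((dot u1 x + m1) - (dot u2 x + m2) = 0 -> x \in realize t2).
  move=> s1 s2 d1 x /imfsetP[I /= It ->].
  have Ik := delaunay_ksub gA d1 It.
  have [l1 [_ /(_ It) e1]] := s1 I Ik; have [l2 e2] := s2 I Ik.
  split; first by lra.
  move=> e; apply: in_imfset => /=; apply/e2; lra.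
have val t1 u1 m1 (w : plane R -> R) : \sum_(x <- realize t1) w x = 1 ->
    dot u1 (\sum_(x <- realize t1) w x *: x) + m1 =
    \sum_(x <- realize t1) w x * (dot u1 x + m1).
  move=> w1; rewrite dot_sumr -[m1 in LHS]mul1r -w1 mulr_suml -big_split /=.
  by apply: eq_bigr => x _; rewrite dotZr mulrDr.
move=> [w [w0 w1 yE]] [w' [w0' w1' yE']].
have n1 : forall x, x \in realize t ->
    0 <= w x * ((dot u x + m) - (dot u' x + m')).
  by move=> x xt; rewrite mulr_ge0 ?w0//; have [] := lem t t' _ _ _ _ h h' dt x xt.
have n2 : 0 <= \sum_(x <- realize t') w' x * ((dot u' x + m') - (dot u x + m)).
  rewrite big_seq; apply: sumr_ge0 => x xt.
  by rewrite mulr_ge0 ?w0'//; have [] := lem t' t _ _ _ _ h' h dt' x xt.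
have a1 := val _ u m _ w1; have a2 := val _ u' m' _ w1.
have a3 := val _ u m _ w1'; have a4 := val _ u' m' _ w1'.
rewrite -yE in a1 a2; rewrite -yE' in a3 a4.
have s0 : \sum_(x <- realize t) w x * ((dot u x + m) - (dot u' x + m')) = 0.
  have n1' : 0 <= \sum_(x <- realize t) w x * ((dot u x + m) - (dot u' x + m')).
    by rewrite big_seq; apply: sumr_ge0.
  move: n1' n2; under eq_bigr do rewrite mulrBr.
  under [X in _ -> 0 <= X -> _]eq_bigr do rewrite mulrBr.
  by rewrite !sumrB -a1 -a2 -a3 -a4; lra.
have z x : x \in realize t -> x \notin realize t' -> w x = 0.
  move=> xt xt'; move/eqP: s0; rewrite big_seq psumr_eq0//.
  move=> /allP/(_ x xt); rewrite xt /= mulf_eq0 => /orP[/eqP//|/eqP e].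
  by have [_ /(_ e)] := lem t t' _ _ _ _ h h' dt x xt; rewrite (negbTE xt').
have sub : realize t `&` realize t' `<=` realize t by exact: fsubsetIl.
have red (V : nmodType) (F : plane R -> V) : (forall x, w x = 0 -> F x = 0) ->
    \sum_(x <- realize t) F x = \sum_(x <- realize t `&` realize t') F x.
  move=> Fz; rewrite (sum_subset _ sub) [RHS]big_mkcond /=.
  rewrite big_seq [RHS]big_seq; apply: eq_bigr => x xt; rewrite inE xt /=.
  by case: ifPn => // xt'; apply/Fz/z.
exists w; split.
- by move=> x; rewrite inE => /andP[/w0].
- by rewrite -w1 -red.
- by rewrite yE -red// => x ->; rewrite scale0r.
Qed.
End Structure.

Section Support.
Variable R : realType.
Implicit Types (u v x y z n o : plane R) (s e : R) (I J K A X : {fset plane R}).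
Implicit Types (a b c : plane R).

Lemma leq_card3 (K : choiceType) (a b c : K) : (#|` [fset a; b; c]| <= 3)%N.
Proof.
rewrite fsetUC cardfsU1 cardfs2 -[3%N]/(1 + 2)%N leq_add//; first by case: (_ \notin _).
by case: (a != b).
Qed.

Lemma exchange A k I x y (o : plane R) s : I \in ksubsets A k ->
  (forall J, J \in ksubsets A k ->
     \sum_(z <- I) pw o s z <= \sum_(z <- J) pw o s z) ->
  x \in I -> y \in A -> y \notin I -> pw o s x <= pw o s y.
Proof.
move=> /ksubsetsP[IA cI] mI xI yA yI.
have yI' : y \notin I `\ x by rewrite !inE (negbTE yI) andbF.
have /mI : y |` (I `\ x) \in ksubsets A k.
  apply/ksubsetsP; split.
    apply/fsubsetP => z; rewrite !inE => /orP[/eqP ->//|/andP[_]]; exact: (fsubsetP IA).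
  by rewrite cardfsU1 yI' -cI (cardfsD1 x I) xI.
rewrite big_fsetU1//= (big_fsetD1 x xI)/=; lra.
Qed.

Lemma sub4 (S : {fset plane R}) : (4 <= #|` S|)%N ->
  exists2 B : {fset plane R}, B `<=` S & #|` B| = 4%N.
Proof.
move=> h; exists [fset x in take 4 (enum_fset S)].
  by apply/fsubsetP => x; rewrite inE => /mem_take.
rewrite card_fseq undup_id ?take_uniq ?fset_uniq// size_take.
by case: ltnP => // h'; apply/eqP; rewrite eqn_leq h h'.
Qed.

Lemma tri_of_supp A k u e I1 I2 I3 : generic A -> (0 < k)%N ->
  I1 \in ksubsets A k -> I2 \in ksubsets A k -> I3 \in ksubsets A k ->
  [/\ I1 != I2, I1 != I3 & I2 != I3] ->
  (forall I, I \in ksubsets A k -> dot u (bary I) + e <= hgt I) ->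
  dot u (bary I1) + e = hgt I1 -> dot u (bary I2) + e = hgt I2 ->
  dot u (bary I3) + e = hgt I3 -> delaunay_triangles A k [fset I1; I2; I3].
Proof.
move=> gA k0 k1 k2 k3 ne le e1 e2 e3; have [n12 n13 n23] := ne.
have kR : (k%:R : R) != 0 by rewrite pnatr_eq0 -lt0n.
pose o := (k%:R * 2)^-1 *: u.
have uE p : dot u p = k%:R * (2 * dot o p).
  rewrite /o dotZl; field; exact: kR.
have FE s I : I \in ksubsets A k ->
    \sum_(x <- I) pw o s x = hgt I - dot u (bary I) + k%:R * (dot o o - s).
  by move=> /ksubsetsP[_ cI]; rewrite sum_pw cI// -uE.
have mn s I : I \in ksubsets A k -> dot u (bary I) + e = hgt I -> forall J, J \in ksubsets A k ->
     \sum_(z <- I) pw o s z <= \sum_(z <- J) pw o s z.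
  by move=> Ik eI J Jk; rewrite !FE//; have := le J Jk; lra.
have [[A1 c1] [A2 c2] [A3 c3]] :
    [/\ I1 `<=` A /\ #|` I1| = k, I2 `<=` A /\ #|` I2| = k & I3 `<=` A /\ #|` I3| = k].
  by split; apply/ksubsetsP.
have dif I J : #|` I| = k -> #|` J| = k -> I != J -> exists x, x \in I /\ x \notin J.
  move=> cI cJ nIJ; have /fset0Pn[x] : I `\` J != fset0.
    by rewrite fsetD_eq0; apply: contra nIJ => IJ; rewrite eqEfcard IJ cI cJ leqnn.
  by rewrite inE => /andP[xJ xI]; exists x.
have [x0 [x01 x02]] := dif I1 I2 c1 c2 n12.
have [y0 [y02 y01]] : exists y, y \in I2 /\ y \notin I1.
  by apply: dif => //; rewrite eq_sym.
have x0A := fsubsetP A1 _ x01; have y0A := fsubsetP A2 _ y02.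
have exy : pw o 0 x0 = pw o 0 y0.
  apply/le_anti/andP; split.
    exact: (exchange k1 (mn 0 _ k1 e1)).
  exact: (exchange k2 (mn 0 _ k2 e2)).
pose s := pw o 0 x0.
have pws x : pw o s x = pw o 0 x - s by rewrite /pw; ring.
pose X := [fset x in A | pw o s x < 0].
have XA : X `<=` A by apply/fsubsetP => x; rewrite !inE => /andP[].
have I1f x : x \in I1 -> pw o s x <= 0.
  by move=> xI; rewrite pws /s exy subr_le0; apply: (exchange k1 (mn 0 _ k1 e1)).
have XI1 : X `<=` I1.
  apply/fsubsetP => x; rewrite !inE => /andP[xA]; apply: contraTT => xI.
  by rewrite -leNgt pws subr_ge0; apply: (exchange k1 (mn 0 _ k1 e1)).
have m1 : \sum_(x <- X) pw o s x = \sum_(x <- I1) pw o s x.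
  by have [_ ->] := min_sum A1 (erefl X).
have all I : I \in ksubsets A k -> dot u (bary I) + e = hgt I ->
    X `<=` I /\ forall x, x \in I -> pw o s x <= 0.
  move=> Ik eI; have [IA _] := ksubsetsP _ _ _ Ik.
  by have [_ <-] := min_sum IA (erefl X); rewrite m1 !FE//; lra.
pose O := [fset x in A | pw o s x == 0].
have OA : O `<=` A by apply/fsubsetP => x; rewrite !inE => /andP[].
have IXO I : I \in ksubsets A k -> dot u (bary I) + e = hgt I -> I `<=` X `|` O.
  move=> Ik eI; have [_ h] := all I Ik eI; have [IA _] := ksubsetsP _ _ _ Ik.
  apply/fsubsetP => x xI; have := h x xI; rewrite le_eqVlt !inE (fsubsetP IA)//=.
  by rewrite orbC.
have [XI2 _] := all I2 k2 e2; have [XI3 _] := all I3 k3 e3.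
have x0X : x0 \notin X by apply: contra x02; exact: (fsubsetP XI2).
have y0X : y0 \notin X by apply: contra y01; exact: (fsubsetP XI1).
have x0O : x0 \in O by rewrite !inE x0A pws /s subrr eqxx.
have y0O : y0 \in O by rewrite !inE y0A pws /s exy subrr eqxx.
have xy : x0 != y0 by apply: contraNneq y01 => <-.
have s0 : 0 < s.
  rewrite lt_neqAle eq_sym /s {2}/pw subr0 dot_ge0 andbT.
  apply: contraNneq xy => h; have := h; rewrite exy; move: h; rewrite /pw !subr0.
  by move/eqP; rewrite dot_eq0 subr_eq0 => /eqP -> /eqP; rewrite dot_eq0 subr_eq0 => /eqP ->.
have O3 : (#|` O| <= 3)%N.
  rewrite leqNgt; apply/negP => /sub4[B BO B4].
  apply: (gA.2 B (fsubset_trans BO OA) B4); exists o, (Num.sqrt s); split.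
    by rewrite sqrtr_gt0.
  move=> x /(fsubsetP BO); rewrite !inE => /andP[_].
  by rewrite -{1}(sqr_sqrtr (ltW s0)) pw_dist ?sqrtr_ge0// => /eqP.
have dXO x : x \in O -> x \notin X.
  by rewrite !inE => /andP[_ /eqP ->]; rewrite ltxx andbF.

have sz I : X `<=` I -> (#|` I `\` X| + #|` X| = #|` I|)%N.
  by move=> XI; rewrite cardfsD (fsetIidPr XI) subnK// fsubset_leq_card.
have sub1 : I1 `\` X `<=` O `\ y0.
  apply/fsubsetP => x; rewrite in_fsetD => /andP[xX xI].
  have := fsubsetP (IXO _ k1 e1) x xI; rewrite in_fsetU (negbTE xX) /= => xO.
  rewrite in_fsetD1 xO andbT; by apply: contraTneq xI => ->.
have j1 : (0 < #|` I1 `\` X|)%N.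
  by rewrite cardfs_gt0; apply/fset0Pn; exists x0; rewrite in_fsetD x0X.
have j2 : (#|` I1 `\` X| < #|` O|)%N.
  by rewrite (cardfsD1 y0 O) y0O add1n ltnS fsubset_leq_card.
have [OE|[z [zx zy OE]]] : O = [fset x0; y0; y0] \/
    exists z, [/\ z != x0, z != y0 & O = [fset x0; y0; z]].
- have OE : O = x0 |` (y0 |` ((O `\ x0) `\ y0)).
    by rewrite fsetD1K ?fsetD1K// in_fsetD1 eq_sym xy y0O.
  have : (#|` (O `\ x0) `\ y0| <= 1)%N.
    move: O3; rewrite (cardfsD1 x0 O) x0O (cardfsD1 y0 (O `\ x0)).
    by rewrite in_fsetD1 eq_sym xy y0O.
  case: (posnP #|` (O `\ x0) `\ y0|) => [/eqP|p0 p1].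
    by rewrite cardfs_eq0 => /eqP h _; left; rewrite OE h fsetU0; apply/fsetP => x;
      rewrite !inE -orbA orbb.
  have /cardfs1P[z zE] : #|` (O `\ x0) `\ y0| == 1%N by rewrite eqn_leq p1.
  right; exists z; have : z \in (O `\ x0) `\ y0 by rewrite zE inE.
  rewrite in_fsetD1 in_fsetD1 => /and3P[zy zx _]; split=> //.
  by rewrite OE zE; apply/fsetP => x; rewrite !inE orbA.
- have cO : #|` O| = 2%N.
    rewrite OE (_ : [fset x0; y0; y0] = [fset x0; y0]) ?cardfs2 ?xy//.
    by apply/fsetP => x; rewrite !inE -orbA orbb.
  have jE : #|` I1 `\` X| = 1%N by move: j1 j2; rewrite cO; case: #|` _| => [|[]].
  have kE : k = (#|` X| + 1)%N by rewrite -c1 -(sz I1)// jE addnC.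
  have mem I : I \in ksubsets A k -> dot u (bary I) + e = hgt I ->
      (I == X `|` [fset x0]) || (I == X `|` [fset y0]).
    move=> Ik eI; have [_ cI] := ksubsetsP _ _ _ Ik; have [XI _] := all I Ik eI.
    have := @between1 _ x0 y0 y0 X I XI; rewrite -OE => /(_ (IXO I Ik eI)).
    by rewrite cI => /(_ kE); rewrite !inE -orbA orbb.
  move: n12 n13 n23.
  by case/orP: (mem _ k1 e1) => /eqP ->; case/orP: (mem _ k2 e2) => /eqP ->;
    case/orP: (mem _ k3 e3) => /eqP ->; rewrite ?eqxx.
have d3 : [/\ x0 != y0, x0 != z & y0 != z] by split=> //; rewrite eq_sym.
have c3' : #|` [fset x0; y0; z]| = 3%N by apply/card3P.
have sub : [fset x0; y0; z] `<=` A by rewrite -OE.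
have zO : z \in O by rewrite OE !inE eqxx orbT.
have XE : inside A x0 y0 z = X.
  have [ o' [s' [-> OE' D0 _]]] := circ_data gA sub c3'.
  have p x : x \in O -> pw o s x = 0 by rewrite !inE => /andP[_ /eqP].
  have p' x : x \in O -> pw o' s' x = 0.
    by move=> xO; apply/eqP; rewrite OE' -?OE// (fsubsetP OA).
  by have [-> ->] := center_uniq D0 (p' _ x0O) (p' _ y0O) (p' _ zO)
    (p _ x0O) (p _ y0O) (p _ zO).
have fin t : (#|` t| <= 3)%N -> I1 \in t -> I2 \in t -> I3 \in t -> [fset I1; I2; I3] = t.
  move=> ct t1 t2 t3; apply/eqP; rewrite eqEfcard ((card3P I1 I2 I3).2 ne) ct andbT.
  by apply/fsubsetP => I; rewrite !inE => /orP[/orP[]|] /eqP ->.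
move: j2; rewrite OE c3'; case: (#|` _|) (sz I1 XI1) j1 => [//|[|[|//]]] szE _ _.
- have kE : k = (#|` X| + 1)%N by rewrite -c1 -szE addnC.
  right; exists x0, y0, z; split=> //; first by rewrite XE.
  have m I : I \in ksubsets A k -> dot u (bary I) + e = hgt I ->
      I \in [fset X `|` [fset x0]; X `|` [fset y0]; X `|` [fset z]].
    move=> Ik eI; have [_ cI] := ksubsetsP _ _ _ Ik; have [XI _] := all I Ik eI.
    by apply: between1 => //; rewrite -?OE ?cI//; exact: IXO.
  by rewrite XE; apply: fin; rewrite ?leq_card3//; apply: m.
- have kE : k = (#|` X| + 2)%N by rewrite -c1 -szE addnC.
  left; exists x0, y0, z; split=> //; first by rewrite XE.
  have m I : I \in ksubsets A k -> dot u (bary I) + e = hgt I ->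
      I \in [fset X `|` [fset x0; y0]; X `|` [fset x0; z]; X `|` [fset y0; z]].
    move=> Ik eI; have [_ cI] := ksubsetsP _ _ _ Ik; have [XI _] := all I Ik eI.
    by apply: between2 => //; rewrite -?OE ?cI//; [exact: dXO|exact: IXO].
  by rewrite XE; apply: fin; rewrite ?leq_card3//; apply: m.
Qed.
End Support.

Section Comb.
Variable R : realType.
Implicit Types (u x y z n o p : plane R) (s e c : R).
Implicit Types (S : {fset plane R}).

Definition hom p : 'rV[R]_3 :=
  \row_j (if j == 0 then p 0 0 else if j == 1 then p 0 1 else 1).

Lemma hom_inj p p' : hom p = hom p' -> p = p'.
Proof.
move=> /rowP h; apply: point_eq; first by have := h 0; rewrite !mxE.
by have := h 1; rewrite !mxE.
Qed.

Definition comb m (q : 'I_m -> plane R) (v : 'I_m -> R) y :=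
  [/\ forall i, 0 <= v i, \sum_i v i = 1 & \sum_i v i *: q i = y].

Lemma sum_hom m (q : 'I_m -> plane R) (v : 'I_m -> R) y :
  \sum_i v i *: hom (q i) = hom y <->
  \sum_i v i = 1 /\ \sum_i v i *: q i = y.
Proof.
have E j : (\sum_i v i *: hom (q i)) 0 j =
    if j == 0 then (\sum_i v i *: q i) 0 0 else
    if j == 1 then (\sum_i v i *: q i) 0 1 else \sum_i v i.
  rewrite summxE; case: ifP => [j0|j0]; [|case: ifP => j1].
  - by rewrite summxE; apply: eq_bigr => i _; rewrite !mxE j0.
  - by rewrite summxE; apply: eq_bigr => i _; rewrite !mxE j0 j1.
  - by apply: eq_bigr => i _; rewrite !mxE j0 j1 mulr1.
split=> [/rowP h|[h1 h2]].
  have h0 := h 0; have h1 := h 1; have h2 := h 2%:R; rewrite !E !mxE/= in h0 h1 h2.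
  by split=> //; apply: point_eq.
by apply/rowP => j; rewrite E h1 h2 !mxE.
Qed.

Lemma sum_hom0 m (q : 'I_m -> plane R) (v : 'I_m -> R) :
  \sum_i v i *: hom (q i) = 0 ->
  \sum_i v i = 0 /\ \sum_i v i *: q i = 0.
Proof.
move=> /rowP h; split.
  have := h 2%:R; rewrite summxE [RHS]mxE => e; rewrite -[RHS]e.
  by apply: eq_bigr => i _; rewrite !mxE/= mulr1.
apply: point_eq; rewrite summxE [RHS]mxE.
  have := h 0; rewrite summxE [RHS]mxE => e; rewrite -[RHS]e.
  by apply: eq_bigr => i _; rewrite !mxE.
have := h 1; rewrite summxE [RHS]mxE => e; rewrite -[RHS]e.
by apply: eq_bigr => i _; rewrite !mxE.
Qed.

Definition homM m (q : 'I_m -> plane R) : 'M[R]_(m, 3) := \matrix_i hom (q i).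

Lemma mul_homM m (q : 'I_m -> plane R) (v : 'rV[R]_m) :
  v *m homM q = \sum_i v 0 i *: hom (q i).
Proof. by rewrite mulmx_sum_row; apply: eq_bigr => i _; rewrite rowK. Qed.

Lemma not_unit_collinear (q : 'I_3 -> plane R) : homM q \notin unitmx ->
  exists n c, n != 0 /\ forall i, dot n (q i) = c.
Proof.
rewrite unitmxE unitfE negbK -det_tr => /det0P[v v0 vq].
have E i : v 0 0 * q i 0 0 + v 0 1 * q i 0 1 + v 0 2%:R = 0.
  have /rowP/(_ i) := vq; rewrite !mxE !big_ord_recl big_ord0 !mxE/= => <-.
  rewrite (_ : lift _ _ = 1); last exact/val_inj.
  rewrite (_ : lift _ _ = 2%:R); last exact/val_inj.
  by rewrite mulr1 addr0 addrA.
pose n : plane R := \row_i (if i == 0 then v 0 0 else v 0 1).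
exists n, (- v 0 2%:R); split; last first.
  by move=> i; have := E i; rewrite dotE !mxE/=; lra.
apply: contra v0 => /eqP/rowP h.
have h0 : v 0 0 = 0 by have := h 0; rewrite !mxE.
have h1 : v 0 1 = 0 by have := h 1; rewrite !mxE.
have := E 0; rewrite h0 h1 !mul0r !add0r => h2.
apply/eqP/rowP => -[[|[|[|//]]] i]; rewrite !mxE.
- by rewrite (_ : Ordinal i = 0)//; exact/val_inj.
- by rewrite (_ : Ordinal i = 1)//; exact/val_inj.
- by rewrite (_ : Ordinal i = 2%:R)//; exact/val_inj.
Qed.

Lemma comb_unit (q : 'I_3 -> plane R) v y : homM q \in unitmx ->
  comb q v y -> \row_i v i = hom y *m invmx (homM q).
Proof.
move=> qU [_ v1 vy]; rewrite -[LHS](mulmxK qU); congr (_ *m _).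
rewrite mul_homM; under eq_bigr do rewrite mxE.
exact/sum_hom.
Qed.

Lemma unit_comb (q : 'I_3 -> plane R) y : homM q \in unitmx ->
  let v := hom y *m invmx (homM q) in
  \sum_i v 0 i = 1 /\ \sum_i v 0 i *: q i = y.
Proof. by move=> qU v; apply/sum_hom; rewrite -mul_homM /v mulmxKV. Qed.

Lemma unit_inj (q : 'I_3 -> plane R) i j : homM q \in unitmx -> q i = q j -> i = j.
Proof.
move=> qU e; have : (delta_mx 0 i : 'rV[R]_3) *m homM q = delta_mx 0 j *m homM q.
  by rewrite -!rowE !rowK e.
move=> /(can_inj (mulmxK qU))/rowP/(_ j); rewrite !mxE !eqxx /= eq_sym.
by case: eqP => // _ /eqP; rewrite eq_sym oner_eq0.
Qed.

Lemma drop m (w d : 'I_m -> R) :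
  (forall i, 0 <= w i) -> (exists i, 0 < d i) ->
  exists j tau, [/\ 0 <= tau, forall i, 0 <= w i - tau * d i, w j - tau * d j = 0 &
    (forall i, 0 < d i -> 0 < w i) -> 0 < tau].
Proof.
move=> w0 [i0 di0].
have [j dj min_j] := @arg_minP _ _ _ i0 (fun i => 0 < d i) (fun i => w i / d i) di0.
exists j, (w j / d j); split.
- by rewrite divr_ge0 ?w0// ltW.
- move=> i; case: (ltP 0 (d i)) => di.
    by have := min_j i di; rewrite ler_pdivlMr// subr_ge0.
  by have := mulr_ge0_le0 (divr_ge0 (w0 j) (ltW dj)) di; have := w0 i; lra.
- by rewrite divfK ?subrr// gt_eqF.
- by move=> h; rewrite divr_gt0 ?h.
Qed.

Lemma comb_drop m (q : 'I_m.+1 -> plane R) v d y : comb q v y ->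
  \sum_i d i = 0 -> \sum_i d i *: q i = 0 -> (exists i, 0 < d i) ->
  exists j tau, [/\ 0 <= tau,
    comb (fun i => q (lift j i)) (fun i => v (lift j i) - tau * d (lift j i)) y,
    v j - tau * d j = 0 &
    (forall i, 0 < d i -> 0 < v i) -> 0 < tau].
Proof.
move=> [v0 v1 vy] d1 dq dp; have [j [tau [t0 h0 hj tp]]] := drop v0 dp.
exists j, tau; split=> //; split=> // [|].
  have : \sum_i (v i - tau * d i) = 1.
    by rewrite sumrB -mulr_sumr v1 d1 mulr0 subr0.
  by rewrite (bigD1_ord j)//= hj add0r.
have : \sum_i (v i - tau * d i) *: q i = y.
  under eq_bigr do rewrite scalerBl -scalerA.
  by rewrite sumrB -scaler_sumr vy dq scaler0 subr0.
by rewrite (bigD1_ord j)//= hj scale0r add0r.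
Qed.

Lemma dep4 (q : 'I_4 -> plane R) : exists d : 'I_4 -> R,
  [/\ \sum_i d i = 0, \sum_i d i *: q i = 0 & exists i, 0 < d i].
Proof.
have : kermx (homM q) != 0.
  by rewrite kermx_eq0 /row_free neq_ltn ltnS rank_leq_col.
move=> /rowV0Pn[v /sub_kermxP]; rewrite mul_homM => /sum_hom0[d0 dq] v0.
exists (fun i => v 0 i); split=> //.
apply: contrapT => np.
have le i : 0 <= - v 0 i.
  by rewrite oppr_ge0 leNgt; apply/negP => h; apply: np; exists i.
have /eqP : \sum_i - v 0 i = 0 by rewrite sumrN d0 oppr0.
rewrite psumr_eq0; last by move=> i _.
move=> /allP h; move: v0; apply/negP/negPn/eqP/rowP => i; rewrite mxE.
by have := h i (mem_index_enum _); rewrite /= oppr_eq0 => /eqP.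
Qed.

Lemma carath (s : seq (plane R)) (w : plane R -> R) :
  (forall x, x \in s -> 0 <= w x) -> \sum_(x <- s) w x = 1 ->
  exists (q : 'I_3 -> plane R) v, (forall i, q i \in s) /\
    comb q v (\sum_(x <- s) w x *: x).
Proof.
elim: s w => [|p s IH] w w0; first by rewrite big_nil => /eqP; rewrite eq_sym oner_eq0.
rewrite !big_cons => w1.
have sw0 : 0 <= \sum_(x <- s) w x.
  by rewrite big_seq; apply: sumr_ge0 => x xs; rewrite w0// inE xs orbT.
have wp : 0 <= w p by rewrite w0// inE eqxx.
move: sw0; rewrite le_eqVlt => /orP[/eqP sw0|sw0].
  have z : \sum_(x <- s) w x *: x = 0.
    have /esym/eqP := sw0; rewrite big_seq psumr_eq0; last first.
      by move=> x xs; rewrite w0// inE xs orbT.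
    move=> /allP h; rewrite big_seq big1// => x xs.
    by have := h x xs; rewrite xs => /eqP ->; rewrite scale0r.
  exists (fun=> p), (fun i => (i == 0)%:R); split; first by move=> _; rewrite inE eqxx.
  rewrite z addr0 (_ : w p = 1) ?scale1r; last by rewrite -w1 -sw0 addr0.
  split; first by move=> i; rewrite ler0n.
    by rewrite !big_ord_recl big_ord0/= !addr0.
  by rewrite !big_ord_recl big_ord0/= scale1r !scale0r !addr0.
set T := \sum_(x <- s) w x in sw0 w1.
have [||q [v [qs [v0 v1 vy]]]] := IH (fun x => w x / T).
- by move=> x xs; rewrite divr_ge0 ?w0 ?inE ?xs ?orbT// ltW.
- by rewrite -mulr_suml divff// gt_eqF.
have {}vy : T *: \sum_i v i *: q i = \sum_(x <- s) w x *: x.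
  rewrite vy scaler_sumr; apply: eq_bigr => x _.
  by rewrite scalerA mulrC divfK// gt_eqF.
pose q4 (i : 'I_4) := oapp q p (unlift ord0 i).
pose v4 (i : 'I_4) := oapp (fun j => T * v j) (w p) (unlift ord0 i).
have c4 : comb q4 v4 (w p *: p + \sum_(x <- s) w x *: x).
  split.
  - by move=> i; rewrite /v4; case: unliftP => [j|] _ //=; rewrite mulr_ge0// ltW.
  - rewrite big_ord_recl /v4 unlift_none /= -[RHS]w1; congr (_ + _).
    by under eq_bigr do rewrite liftK /=; rewrite -mulr_sumr v1 mulr1.
  - rewrite big_ord_recl /v4 /q4 unlift_none /= -vy; congr (_ + _).
    under eq_bigr do rewrite liftK /= -scalerA; by rewrite scaler_sumr.
have [d [d0 dq dp]] := dep4 q4.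
have [j [tau [_ cc _ _]]] := comb_drop c4 d0 dq dp.
exists (fun i => q4 (lift j i)), (fun i => v4 (lift j i) - tau * d (lift j i)); split=> //.
move=> i; rewrite /q4; case: unliftP => [l|] _ /=; last by rewrite inE eqxx.
by rewrite inE qs orbT.
Qed.

Lemma conv_fam m (q : 'I_m -> plane R) v y S : comb q v y ->
  (forall i, q i \in S) -> conv S y.
Proof.
move=> [v0 v1 vy] qS; exists (fun x => \sum_(i | q i == x) v i); split.
- by move=> x _; apply: sumr_ge0.
- rewrite -v1; under eq_bigr do rewrite big_mkcond /=.
  rewrite exchange_big /=; apply: eq_bigr => i _.
  rewrite (big_fsetD1 (q i))//= eqxx big_seq big1 ?addr0// => x.
  by rewrite !inE eq_sym => /andP[/negbTE ->].
- rewrite -vy; under [RHS]eq_bigr do rewrite scaler_suml big_mkcond /=.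
  rewrite exchange_big /=; apply: eq_bigr => i _.
  rewrite (big_fsetD1 (q i))//= eqxx big_seq big1 ?addr0// => x.
  by rewrite !inE eq_sym => /andP[/negbTE ->].
Qed.

Lemma conv_carath S y : conv S y -> exists (q : 'I_3 -> plane R) v,
  (forall i, q i \in S) /\ comb q v y.
Proof. by move=> [w [w0 w1 ->]]; exact: carath. Qed.

Lemma conv_cvx S y z t : conv S y -> conv S z -> 0 <= t -> t <= 1 ->
  conv S (y + t *: (z - y)).
Proof.
move=> [w [w0 w1 ->]] [w' [w0' w1' ->]] t0 t1.
exists (fun x => (1 - t) * w x + t * w' x); split.
- by move=> x xS; rewrite addr_ge0// mulr_ge0 ?w0 ?w0'// subr_ge0.
- by rewrite big_split -!mulr_sumr w1 w1' /=; ring.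
- under [RHS]eq_bigr do rewrite scalerDl -!scalerA.
  rewrite big_split -!scaler_sumr /= scalerBl scale1r scalerBr.
  by rewrite addrAC addrA.
Qed.

Definition gen S y := forall p p', p \in S -> p' \in S -> p != p' -> det3 p p' y != 0.

Lemma gen_unit S (q : 'I_3 -> plane R) v y : ~ collinear S -> gen S y ->
  (forall i, q i \in S) -> comb q v y -> homM q \in unitmx.
Proof.
move=> nS gy qS [v0 v1 vy]; apply/negPn/negP => /not_unit_collinear[n [c [n0 h]]].
have yc : dot n y = c.
  by rewrite -vy dot_sumr; under eq_bigr do rewrite dotZr h; rewrite -mulr_suml v1 mul1r.
have perp0 p p' : dot n p = c -> dot n p' = c -> det3 p p' y = 0.
  by move=> e1 e2; apply: (perp_cross n0); rewrite dotBr ?e1 ?e2 ?yc subrr.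
have q0 i : q i = q 0.
  apply/eqP/negPn/negP => ne; have := gy _ _ (qS i) (qS 0) ne.
  by rewrite perp0 ?eqxx ?h.
have yE : y = q 0.
  by rewrite -vy; under eq_bigr do rewrite q0; rewrite -scaler_suml v1 scale1r.
apply: nS; exists n, c; split=> // x xS; have [->//|ne] := eqVneq x (q 0).
have := gy _ _ xS (qS 0) ne; rewrite yE /det3 /cross !mxE => /negP[].
by apply/eqP; ring.
Qed.

Lemma gen_pos S (q : 'I_3 -> plane R) v y : gen S y ->
  (forall i, q i \in S) -> comb q v y -> homM q \in unitmx -> forall i, 0 < v i.
Proof.
move=> gy qS [v0 v1 vy] qU i; rewrite lt_neqAle v0 andbT eq_sym; apply/eqP => vi.
move: v1 vy; rewrite !(bigD1_ord i)//= vi scale0r !add0r.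
set j := lift i 0; set l := lift i 1.
have E (V : nmodType) (F : 'I_2 -> V) : \sum_i F i = F 0 + F 1.
  by rewrite !big_ord_recl big_ord0 addr0; congr (_ + F _); apply/val_inj.
rewrite !E -/j -/l => v1 vy.
have jl : q j != q l.
  by apply/eqP => /(unit_inj qU)/lift_inj.
have := gy _ _ (qS j) (qS l) jl; rewrite -vy (_ : v l = 1 - v j); last by rewrite -v1; ring.
by rewrite /det3 /cross !mxE => /negP[]; apply/eqP; ring.
Qed.
End Comb.

Section Cover.
Variable R : realType.
Implicit Types (u x y z p : plane R) (s e : R) (I J A : {fset plane R}).
Implicit Types (S : {fset plane R}).

Lemma gen_cover A k y : generic A -> (0 < k)%N -> ~ collinear (level A k) ->
  gen (level A k) y -> conv (level A k) y ->
  exists (q : {ffun 'I_3 -> ksubsets A k}) v,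
  [/\ delaunay_triangles A k [fset val (q 0); val (q 1); val (q 2%:R)],
      homM (fun i => bary (val (q i))) \in unitmx & comb (fun i => bary (val (q i))) v y].
Proof.
move=> gA k0 nS gy cy; pose S := level A k.
pose b (q : {ffun 'I_3 -> ksubsets A k}) i := bary (val (q i)).
have bS (I : ksubsets A k) : bary (val I) \in S by apply: in_imfset; exact: valP.
have bqS q i : b q i \in S by exact: bS.
pose P q := `[< exists v, comb (b q) v y >].
pose h (I : ksubsets A k) := hgt (val I).
pose W q := \sum_i (hom y *m invmx (homM (b q))) 0 i * h (q i).
have WE q v : comb (b q) v y -> W q = \sum_i v i * h (q i).
  move=> cv; have qU := gen_unit nS gy (bqS q) cv.
  by rewrite /W -(comb_unit qU cv); apply: eq_bigr => i _; rewrite mxE.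
have [q0 Pq0] : exists q0, P q0.
  have [q [v [qS cv]]] := conv_carath cy.
  have /choice[f fE] : forall i, exists I : ksubsets A k, q i = bary (val I).
    by move=> i; have /imfsetP[I /= Ik ->] := qS i; exists [` Ik].
  exists (finfun f); apply/asboolP; exists v.
  by rewrite (_ : b _ = q)//; apply/funext => i; rewrite /b ffunE fE.
have [q /asboolP[v cv] min_q] := @arg_minP _ _ _ q0 P W Pq0.
have qU := gen_unit nS gy (bqS q) cv.
have vp := gen_pos gy (bqS q) cv qU.
pose M := homM (b q); pose hc : 'cV[R]_3 := \col_i h (q i).
have [g gE] : exists g, g = invmx M *m hc by eexists.
pose G p := (hom p *m g) 0 0.
pose u : plane R := \row_j (if j == 0 then g 0 0 else g 1 0).
pose e := g 2%:R 0.
have GE p : G p = dot u p + e.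
  rewrite /G dotE !mxE !big_ord_recl big_ord0 !mxE/= -/e.
  rewrite (_ : lift _ _ = 1); last exact/val_inj.
  rewrite (_ : lift _ _ = 2%:R); last exact/val_inj.
  by rewrite /e; ring.
have Gq i : G (b q i) = h (q i).
  rewrite /G (_ : hom (b q i) = row i M); last by rewrite rowK.
  by rewrite gE mulmxA rowE -[_ *m M *m _]mulmxA mulmxV// mulmx1 -rowE !mxE.
have low (J : ksubsets A k) : G (bary (val J)) <= h J.
  rewrite leNgt; apply/negP => hJ.
  pose be := hom (bary (val J)) *m invmx M.
  have [be1 beq] := unit_comb (bary (val J)) qU; rewrite -/M -/be in be1 beq.
  pose q4 (i : 'I_4) := oapp q J (unlift ord0 i).
  pose v4 (i : 'I_4) := oapp v 0 (unlift ord0 i).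
  pose d (i : 'I_4) := oapp (fun i => be 0 i) (- 1) (unlift ord0 i).
  have c4 : comb (fun i => bary (val (q4 i))) v4 y.
    have [v0 v1 vy] := cv; split.
    - by move=> i; rewrite /v4; case: unliftP => [j|] _ //=.
    - rewrite big_ord_recl /v4 unlift_none /= add0r -[RHS]v1.
      by apply: eq_bigr => i _; rewrite liftK.
    - rewrite big_ord_recl /v4 /q4 unlift_none /= scale0r add0r -[RHS]vy.
      by apply: eq_bigr => i _; rewrite liftK.
  have d0 : \sum_i d i = 0.
    rewrite big_ord_recl /d unlift_none /=; under eq_bigr do rewrite liftK /=.
    by rewrite be1 addNr.
  have dq : \sum_i d i *: bary (val (q4 i)) = 0.
    rewrite big_ord_recl /d /q4 unlift_none /=; under eq_bigr do rewrite liftK /=.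
    by rewrite beq scaleN1r addNr.
  have dp : exists i, 0 < d i.
    apply: contrapT => np; have : \sum_i be 0 i <= 0.
      apply: sumr_le0 => i _; rewrite leNgt; apply/negP => bi; apply: np.
      by exists (lift ord0 i); rewrite /d liftK.
    by rewrite be1 ler10.
  have [j [tau [_ cc hj tp]]] := comb_drop c4 d0 dq dp.
  have {}tp : 0 < tau.
    by apply: tp => i; rewrite /d /v4; case: unliftP => [l|] _ //=; rewrite oppr_gt0 ltr10.
  pose q' : {ffun 'I_3 -> ksubsets A k} := [ffun i => q4 (lift j i)].
  have cq' : comb (b q') (fun i => v4 (lift j i) - tau * d (lift j i)) y.
    by rewrite (_ : b q' = fun i => bary (val (q4 (lift j i))))//; apply/funext => i; rewrite /b ffunE.
  have := min_q q'; rewrite (WE _ _ cv) (WE _ _ cq').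
  have -> : P q' by apply/asboolP; eexists; exact: cq'.
  move=> /(_ isT); apply/negP; rewrite -ltNge.
  have -> : \sum_i (v4 (lift j i) - tau * d (lift j i)) * h (q' i) =
      \sum_i (v4 i - tau * d i) * h (q4 i).
    rewrite [RHS](bigD1_ord j)//= hj mul0r add0r.
    by apply: eq_bigr => i _; rewrite ffunE.
  under eq_bigr do rewrite mulrBl -mulrA.
  rewrite sumrB -mulr_sumr.
  have -> : \sum_i v4 i * h (q4 i) = \sum_i v i * h (q i).
    rewrite big_ord_recl /v4 /q4 unlift_none /= mul0r add0r.
    by apply: eq_bigr => i _; rewrite liftK.
  have -> : \sum_i d i * h (q4 i) = G (bary (val J)) - h J.
    rewrite big_ord_recl /d /q4 unlift_none /= mulN1r addrC; congr (_ - _).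
    rewrite /G gE mulmxA -/be mxE; apply: eq_bigr => i _.
    by rewrite liftK /= [hc _ _]mxE.
  by rewrite gtrBl mulr_gt0// subr_gt0.
have ne i j : i != j -> val (q i) != val (q j).
  by apply: contra => /eqP ij; apply/eqP/(unit_inj qU); rewrite /b ij.
exists q, v; split=> //.
apply: (@tri_of_supp _ A k u e) => //; rewrite -?GE; [..|exact: Gq|exact: Gq|exact: Gq].
- exact: valP.
- exact: valP.
- exact: valP.
- by split; exact: ne.
- by move=> I Ik; rewrite -GE; exact: (low [` Ik]).
Qed.

Lemma poly_nonroot (p : {poly R}) (dl : R) : p != 0 -> 0 < dl ->
  exists e, [/\ 0 < e, e < dl & p.[e] != 0].
Proof.
move=> p0 d0; apply: contrapT => np.
pose rs := [seq dl / n.+2%:R | n <- iota 0 (size p)].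
have : (size rs < size p)%N.
  apply: (max_poly_roots p0).
    apply/allP => _ /mapP[n _ ->]; apply/negPn/negP => /negP h; apply: np.
    exists (dl / n.+2%:R); split.
    - by rewrite divr_gt0.
    - by rewrite ltr_pdivrMr// ltr_pMr// ltr1n.
    - by apply/negP.
  rewrite map_inj_uniq ?iota_uniq// => m n.
  have d0' : dl != 0 by rewrite gt_eqF.
  by move/(mulfI d0')/invr_inj/eqP; rewrite eqr_nat => /eqP[].
by rewrite size_map size_iota ltnn.
Qed.

Lemma gen_poly S (X Y : {poly R}) (x : R -> plane R) (dl : R) :
  (forall t, x t 0 0 = X.[t]) -> (forall t, x t 0 1 = Y.[t]) ->
  (forall p p', p \in S -> p' \in S -> p != p' -> exists t, det3 p p' (x t) != 0) ->
  0 < dl -> exists e, [/\ 0 < e, e < dl & gen S (x e)].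
Proof.
move=> hX hY hn d0.
pose D p p' : {poly R} := (p' 0 0 - p 0 0)%:P * (Y - (p 0 1)%:P) -
   (p' 0 1 - p 0 1)%:P * (X - (p 0 0)%:P).
have DE p p' t : (D p p').[t] = det3 p p' (x t).
  by rewrite det3E hX hY !hornerE.
pose Q := \prod_(p <- S) \prod_(p' <- S | p != p') D p p'.
have Q0 : Q != 0.
  rewrite /Q prodf_seq_neq0; apply/allP => p pS /=.
  rewrite prodf_seq_neq0; apply/allP => p' pS' /=; apply/implyP => ne.
  have [t] := hn _ _ pS pS' ne; apply: contraNneq => D0.
  by rewrite -DE D0 horner0.
have [t [t0 td Qt]] := poly_nonroot Q0 d0; exists t; split=> // p p' pS pS' ne.
move: Qt; rewrite /Q horner_prod prodf_seq_neq0 => /allP/(_ p pS) /=.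
rewrite horner_prod prodf_seq_neq0 => /allP/(_ p' pS') /=.
by rewrite ne DE.
Qed.

Lemma noncollinear_det S : ~ collinear S -> exists a b c,
  [/\ a \in S, b \in S, c \in S & det3 a b c != 0].
Proof.
move=> nS; apply: contrapT => np.
have [S0|[a aS]] := fset_0Vmem S.
  apply: nS; exists (\row__ 1), 0; split; last by rewrite S0.
  by apply/eqP => /rowP/(_ 0)/eqP; rewrite !mxE oner_eq0.
have [[b bS ab]|nb] := pselect (exists2 b, b \in S & a != b).
  apply: nS; exists (perp (b - a)), (dot (perp (b - a)) a); split.
    by rewrite perp_neq0// subr_eq0 eq_sym.
  move=> x xS; apply/eqP; rewrite -subr_eq0 -dotBr dot_perp -/(det3 a b x).
  by apply/negPn/negP => h; apply: np; exists a, b, x.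
apply: nS; exists (\row__ 1), (dot (\row__ 1) a); split.
  by apply/eqP => /rowP/(_ 0)/eqP; rewrite !mxE oner_eq0.
move=> x xS; have [->//|ax] := eqVneq a x.
by case: nb; exists x.
Qed.

Lemma exists_gen S : ~ collinear S -> exists z, conv S z /\ gen S z.
Proof.
move=> /noncollinear_det[a [b [c [aS bS cS D0]]]].
pose x (t : R) := a + t *: (b - a) + t ^+ 2 *: (c - a).
pose X := (a 0 0)%:P + 'X * (b 0 0 - a 0 0)%:P + 'X^2 * (c 0 0 - a 0 0)%:P.
pose Y := (a 0 1)%:P + 'X * (b 0 1 - a 0 1)%:P + 'X^2 * (c 0 1 - a 0 1)%:P.
have h2 : 0 < 2^-1 :> R by rewrite invr_gt0.
have [|||t [t0 t2 gt]] := @gen_poly S X Y x 2^-1 _ _ _ h2.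
- by move=> t; rewrite !mxE /X !hornerE.
- by move=> t; rewrite !mxE /Y !hornerE.
- move=> p p' _ _ ne; apply: contrapT => np.
  have h t : det3 p p' (x t) = 0.
    by apply/eqP/negPn/negP => ht; apply: np; exists t.
  have := h 0; have := h 1; have := h (- 1); rewrite !det3E !mxE => em e1 e0.
  have pn : perp (p' - p) != 0 by rewrite perp_neq0// subr_eq0 eq_sym.
  move: D0; rewrite /det3 (perp_cross pn) ?eqxx//; rewrite dot_perp /cross !mxE; lra.
exists (x t); split=> //.
pose q (i : 'I_3) := nth 0 [:: a; b; c] i.
pose v (i : 'I_3) := nth 0 [:: 1 - t - t ^+ 2; t; t ^+ 2] i.
apply: (@conv_fam _ _ q v).
  split.
  - have t20 : 0 <= t ^+ 2 by rewrite sqr_ge0.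
    have t21 : 0 <= 1 - t - t ^+ 2 by nra.
    by case=> -[|[|[|//]]] ?; rewrite /v /=; [exact: t21|exact: ltW|exact: t20].
  - by rewrite !big_ord_recl big_ord0 /v /=; ring.
  - rewrite !big_ord_recl big_ord0 /v /q /= /x addr0.
    by apply/rowP => j; rewrite !mxE; ring.
by case=> -[|[|[|//]]] ?.
Qed.

Lemma gen_near S y z (dl : R) : gen S z -> 0 < dl ->
  exists e, [/\ 0 < e, e < dl & gen S (y + e *: (z - y))].
Proof.
move=> gz; apply: (@gen_poly S ((y 0 0)%:P + 'X * (z 0 0 - y 0 0)%:P)
  ((y 0 1)%:P + 'X * (z 0 1 - y 0 1)%:P) (fun e => y + e *: (z - y))).
- by move=> t; rewrite !mxE !hornerE.
- by move=> t; rewrite !mxE !hornerE.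
by move=> p p' pS pS' ne; exists 1; rewrite scale1r addrC subrK gz.
Qed.

Lemma cover A k y : generic A -> (0 < k)%N -> ~ collinear (level A k) ->
  conv (level A k) y ->
  exists2 t, delaunay_triangles A k t & conv (realize t) y.
Proof.
move=> gA k0 nS cy; have [z [cz gz]] := exists_gen nS.
apply: contrapT => np.
pose b (q : {ffun 'I_3 -> ksubsets A k}) i := bary (val (q i)).
pose bad (q : {ffun 'I_3 -> ksubsets A k}) (e : R) := ~ exists v, [/\ delaunay_triangles A k [fset val (q 0); val (q 1); val (q 2%:R)],
      homM (b q) \in unitmx & comb (b q) v (y + e *: (z - y))].
have /choice[f fP] : forall q, exists dl, 0 < dl /\ forall e, 0 < e -> e < dl -> bad q e.
  move=> q; have [[dt qU]|nd] := pselect (delaunay_triangles A k [fset val (q 0); val (q 1); val (q 2%:R)]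
     /\ homM (b q) \in unitmx); last first.
    by exists 1; split=> // e _ _ [v [h1 h2 _]]; apply: nd.
  pose al i := (hom y *m invmx (homM (b q))) 0 i.
  pose be i := (hom z *m invmx (homM (b q))) 0 i.
  have [i ai] : exists i, al i < 0.
    apply: contrapT => na; apply: np; eexists; first exact: dt.
    have [a1 aq] := unit_comb y qU.
    apply: (@conv_fam _ _ (b q) al).
      split=> // i; rewrite leNgt; apply/negP => h; apply: na; by exists i.
    have qin (i : 'I_3) : val (q i) \in [fset val (q 0); val (q 1); val (q 2%:R)].
      by case: i => -[|[|[|//]]] i; rewrite !inE;
       [rewrite (_ : Ordinal i = 0) ?eqxx//|rewrite (_ : Ordinal i = 1) ?eqxx ?orbT//|
        rewrite (_ : Ordinal i = 2%:R) ?eqxx ?orbT//]; exact/val_inj.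
    by move=> i; apply: in_imfset; exact: qin.
  exists (- al i / (`|be i - al i| + 1)); split.
    by rewrite divr_gt0 ?oppr_gt0// ltr_wpDl.
  move=> e e0; rewrite ltr_pdivlMr ?ltr_wpDl// => ed [v [_ _ cv]].
  have [v0 _ _] := cv; have := v0 i.
  have /rowP/(_ i) := comb_unit qU cv; rewrite mxE => ->.
  have -> : hom (y + e *: (z - y)) = hom y + e *: (hom z - hom y).
    apply/rowP => j; rewrite !mxE; case: ifP => // _; case: ifP => // _.
    by rewrite subrr mulr0 addr0.
  have D (a a' : 'rV[R]_3) : (a + e *: (a' - a)) 0 i = a 0 i + e * (a' 0 i - a 0 i).
    by rewrite !mxE.
  rewrite mulmxDl -scalemxAl mulmxBl D -/(al i) -/(be i) => h.
  have : e * (be i - al i) <= e * `|be i - al i|.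
    by rewrite ler_pM2l// ler_norm.
  by lra.
pose dl := \big[Num.min/1]_q f q.
have d0 : 0 < dl by apply: lt_bigmin => // q _; have [] := fP q.
have [e [e0 ed ge]] := gen_near y gz d0.
have e1 : e <= 1 by apply: (le_trans (ltW ed)); exact: bigmin_le_id.
have [q [v h]] := gen_cover gA k0 nS ge (conv_cvx cy cz (ltW e0) e1).
have [_ /(_ e e0)] := fP q; apply; last by exists v.
by apply: (lt_le_trans ed); exact: bigmin_le.
Qed.

Lemma delaunay_is_hypertriangulation A k :
  generic A -> (1 <= k)%N -> is_hypertriangulation A k (delaunay_triangles A k).
Proof.
move=> gA k0.
have sub t : delaunay_triangles A k t -> realize t `<=` level A k.
  move=> dt; apply/fsubsetP => _ /imfsetP[I /= It ->]; apply: in_imfset.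
  exact: delaunay_ksub dt It.
split.
- by move=> t I; exact: delaunay_ksub.
- by move=> t t' I J; exact: delaunay_label.
- split.
  + move=> _ [t dt <-]; have nc := delaunay_noncollinear gA k0 dt; split=> //.
      exact: sub.
    have [I [J [K tE]]] := delaunay_triple gA dt.
    have rE : realize t = [fset bary I; bary J; bary K] by rewrite tE realize3.
    by rewrite rE; apply/card3P; exact: (collinear3 nc rE).
  + move=> _ _ [t dt <-] [t' dt' <-]; apply/seteqP; split=> y.
      by move=> [y1 y2]; exact: (delaunay_conv gA k0 dt dt' y1 y2).
    by move=> yt; split; [apply: conv_mono yt; exact: fsubsetIl|
      apply: conv_mono yt; exact: fsubsetIr].
  + move=> nS; apply/seteqP; split=> y.
      by move=> [_ [t dt <-]]; apply: conv_mono; exact: sub.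
    by move=> /(cover gA k0 nS)[t dt yt]; exists (realize t) => //; exists t.
- by move=> t I J; exact: delaunay_edge.
Qed.
End Cover.

Definition order_delaunay (R : realType) (A : {fset plane R}) (k : nat)
    (gA : generic A) (k_ge1 : (1 <= k)%N) :
    hypertriangulation A k :=
  Hypertriangulation (delaunay_is_hypertriangulation gA k_ge1).

(* The triangles with vertex labels I, J, K and I, J, L share the edge from
   [I] to [J], and their angles opposite to it are those at [K] and [L]. *)
Definition shared_edge (R : realType) (T : set {fset {fset plane R}})
    (I J K L : {fset plane R}) : Prop :=
  [/\ I != J, K != L, T [fset I; J; K] & T [fset I; J; L]].

Definition opposite_angle (R : realType) (I J K : {fset plane R}) : R :=
  angle (bary K) (bary I) (bary J).

Definition local_angle_property (R : realType) (A : {fset plane R}) (k : nat)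
    (T : hypertriangulation A k) : Prop :=
  [/\ forall I J K L, shared_edge T I J K L ->
        white k [fset I; J; K] -> white k [fset I; J; L] ->
        opposite_angle I J K + opposite_angle I J L <= pi,
      forall I J K L, shared_edge T I J K L ->
        black k [fset I; J; K] -> black k [fset I; J; L] ->
        pi <= opposite_angle I J K + opposite_angle I J L &
      forall I J K L, shared_edge T I J K L ->
        black k [fset I; J; K] -> white k [fset I; J; L] ->
        opposite_angle I J L < opposite_angle I J K].

(* Main.v *)
(* Let the labels of a shared edge be I and J, with I \ J = {p} and J \ I = {q}.
   A triangle on this edge comes from a circle through p, q and a third point
   r, and up to a homothety of ratio 1/k or -1/k its angle opposite the edge is
   the angle of the triangle pqr at r.  The triangle is black if r belongs to
   I /\ J and white otherwise, and a point of A other than r lies inside the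
   circle exactly when it belongs to I /\ J.  So for two triangles, with third
   points r and r', the colour of each tells on which side of the other circle
   its third point lies.  The power of r' with respect to the circle pqr is a
   positive multiple of cot(r') - cot(r) if r and r' lie on the same side of pq,
   and of cot(r') + cot(r) otherwise.  The signs of the two powers therefore
   determine both which of the two situations occurs and the sign of this
   expression, which is the required comparison of angles. *)
Require Import Defs.
From mathcomp Require Import all_boot all_order all_algebra finmap.
From mathcomp Require Import all_classical all_reals all_analysis.
From mathcomp Require Import ring lra.

Set Implicit Arguments.
Unset Strict Implicit.
Unset Printing Implicit Defensive.

Import Order.TTheory GRing.Theory Num.Theory.

Local Open Scope fset_scope.
Local Open Scope ring_scope.

(** * Comparison of angles through cotangents, and the power of a point *)

Section Angles.
Variable R : realType.
Implicit Types (a b c d o p q : plane R) (s t x y : R).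

Lemma ltr_acos x y : -1 <= x <= 1 -> -1 <= y <= 1 -> (acos x < acos y) = (y < x).
Proof.
move=> hx hy.
by rewrite -ltr_cos ?in_itv/= ?acos_ge0 ?acos_lepi// !acosK ?in_itv.
Qed.

Lemma cross_dot (u v : plane R) : cross u v ^+ 2 + dot u v ^+ 2 = dot u u * dot v v.
Proof. by rewrite !dotE /cross; ring. Qed.

Lemma angle_polar p a b : det3 p a b != 0 -> exists N x y,
  [/\ 0 < N, 0 < y, x ^+ 2 + y ^+ 2 = 1, angle p a b = acos x &
   dot (a - p) (b - p) = N * x /\ `|det3 p a b| = N * y].
Proof.
move=> D0; pose N := dist a p * dist b p.
have N2 : N ^+ 2 = `|det3 p a b| ^+ 2 + dot (a - p) (b - p) ^+ 2.
  by rewrite real_normK ?num_real// /det3 cross_dot /N exprMn !dist_sqr.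
have dp : 0 < `|det3 p a b| by rewrite normr_gt0.
have N0 : 0 < N.
  rewrite lt_neqAle mulr_ge0 ?dist_ge0// andbT eq_sym -sqrf_eq0 N2.
  by rewrite gt_eqF// ltr_wpDr ?sqr_ge0// exprn_gt0.
have Nn : N != 0 by rewrite gt_eqF.
exists N, (dot (a - p) (b - p) / N), (`|det3 p a b| / N); split=> //.
- by rewrite divr_gt0.
- by rewrite !expr_div_n -mulrDl addrC -N2 divff// sqrf_eq0.
- by rewrite !(mulrC N) !divfK.
Qed.

Lemma unit_circle_bound x y : x ^+ 2 + y ^+ 2 = 1 -> -1 <= x <= 1.
Proof.
by move=> h; rewrite -ler_norml -(@expr_le1 _ 2)// real_normK ?num_real// -h lerDl sqr_ge0.
Qed.

(** On the open upper half of the unit circle, the cotangent [x / y] and the cosine [x] both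
    decrease as the angle grows, so they induce the same order. *)
Lemma cot_lt x y x' y' : 0 < y -> 0 < y' -> x ^+ 2 + y ^+ 2 = 1 ->
  x' ^+ 2 + y' ^+ 2 = 1 -> x * y' < x' * y -> x < x'.
Proof.
move=> y0 y0' h h' c; rewrite ltNge; apply/negP => xx; move: c; apply/negP.
(* If neither cosine is negative, or neither is positive, comparing squares orders [y] and [y']; for
   opposite signs the products are already ordered. *)
rewrite -leNgt; have [x0'|x0'] := leP 0 x'.
  have x2 : x' ^+ 2 <= x ^+ 2 by rewrite ler_pXn2r// nnegrE (le_trans x0').
  have yy : y <= y' by rewrite -(@ler_pXn2r _ 2) ?nnegrE ?(ltW y0) ?(ltW y0')//; lra.
  by rewrite ler_pM// ltW.
have [x0|x0] := leP x 0; last by nra.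
have x2 : (- x) ^+ 2 <= (- x') ^+ 2 by rewrite ler_pXn2r ?nnegrE ?oppr_ge0 ?lerN2// ltW.
have yy : y' <= y.
  by rewrite -(@ler_pXn2r _ 2) ?nnegrE ?(ltW y0) ?(ltW y0')//; move: x2; rewrite !sqrrN; lra.
by rewrite -lerN2 -!mulNr ler_pM ?oppr_ge0 ?lerN2// ltW.
Qed.

(** Up to the positive factor [N * N'], the hypothesis says that the cotangent at [q] is smaller
    than the one at [p]. *)
Lemma angle_lt p q a b : det3 p a b != 0 -> det3 q a b != 0 ->
  dot (a - q) (b - q) * `|det3 p a b| < dot (a - p) (b - p) * `|det3 q a b| ->
  angle p a b < angle q a b.
Proof.
move=> /angle_polar[N [x [y [N0 y0 h -> [-> ->]]]]].
move=> /angle_polar[N' [x' [y' [N0' y0' h' -> [-> ->]]]]] c.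
rewrite ltr_acos ?(unit_circle_bound h) ?(unit_circle_bound h')//; apply: (cot_lt y0' y0 h' h).
by rewrite -(ltr_pM2l (mulr_gt0 N0 N0')); move: c; congr (_ < _); ring.
Qed.

(** The supplement of the angle at [q] is [acos (- x')], so bounding the sum by [pi] amounts to
    comparing the angle at [p] with this supplement. *)
Lemma angle_sum_ltpi p q a b : det3 p a b != 0 -> det3 q a b != 0 ->
  0 < dot (a - p) (b - p) * `|det3 q a b| + dot (a - q) (b - q) * `|det3 p a b| ->
  angle p a b + angle q a b < pi.
Proof.
move=> /angle_polar[N [x [y [N0 y0 h -> [-> ->]]]]].
move=> /angle_polar[N' [x' [y' [N0' y0' h' -> [-> ->]]]]] c.
have hN : (- x') ^+ 2 + y' ^+ 2 = 1 by rewrite sqrrN.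
rewrite -ltrBrDr -acosN ?(unit_circle_bound h')// ltr_acos ?(unit_circle_bound h) ?(unit_circle_bound hN)//.
apply: (cot_lt y0' y0 hN h).
rewrite -subr_gt0 -(pmulr_rgt0 _ (mulr_gt0 N0 N0')).
by move: c; congr (_ < _); ring.
Qed.

Lemma angle_sum_gtpi p q a b : det3 p a b != 0 -> det3 q a b != 0 ->
  dot (a - p) (b - p) * `|det3 q a b| + dot (a - q) (b - q) * `|det3 p a b| < 0 ->
  pi < angle p a b + angle q a b.
Proof.
move=> /angle_polar[N [x [y [N0 y0 h -> [-> ->]]]]].
move=> /angle_polar[N' [x' [y' [N0' y0' h' -> [-> ->]]]]] c.
have hN : (- x') ^+ 2 + y' ^+ 2 = 1 by rewrite sqrrN.
rewrite -ltrBlDr -acosN ?(unit_circle_bound h')// ltr_acos ?(unit_circle_bound h) ?(unit_circle_bound hN)//.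
apply: (cot_lt y0 y0' h hN).
rewrite -subr_lt0 -(pmulr_rlt0 _ (mulr_gt0 N0 N0')).
by move: c; congr (_ < _); ring.
Qed.

(** The ratio may be negative, as it is for black triangles: the dot product and the product of the
    lengths both scale by [t ^+ 2]. *)
Lemma angle_homothety t p a b p' a' b' : t != 0 ->
  a' - p' = t *: (a - p) -> b' - p' = t *: (b - p) ->
  angle p' a' b' = angle p a b.
Proof.
move=> t0 ha hb; rewrite /angle /dist ha hb.
have dotZZ u v : dot (t *: u) (t *: v) = t ^+ 2 * dot u v by rewrite dotZl dotZr; ring.
rewrite !dotZZ !(sqrtrM _ (sqr_ge0 t)) mulrACA -expr2 sqr_sqrtr ?sqr_ge0//.
by rewrite -mulf_div divff ?mul1r// sqrf_eq0.
Qed.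

Lemma pw_interp o s a b c d :
  pw o s a = 0 -> pw o s b = 0 -> pw o s c = 0 ->
  det3 c a b * pw o s d =
  dot (a - d) (b - d) * det3 c a b - dot (a - c) (b - c) * det3 d a b.
Proof.
move=> ha hb hc.
(* x |-> pw o s x - dot (a - x) (b - x) is affine, hence determined by its values at a, b, c. *)
suff : det3 c a b * (pw o s d - dot (a - d) (b - d)) = pw o s a * det3 d b c +
    pw o s b * det3 a d c + (pw o s c - dot (a - c) (b - c)) * det3 d a b.
  by rewrite ha hb hc mulrBr => h; lra.
by rewrite !det3E /pw !dotE !mxE; ring.
Qed.
End Angles.

(** * Matching and reordering sets listed by three elements *)

Section Triples.
Variables T U : choiceType.

(** This renames the three points so that they match [I], [J], [K] in the given order. Distinct
    labels have distinct preimages, so choosing a preimage of each permutes [a], [b], [c]. *)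
Lemma fset3_image (F : T -> U) a b c (I J K : U) :
  [fset I; J; K] = [fset F a; F b; F c] -> [/\ I != J, I != K & J != K] ->
  exists p q r, [/\ I = F p, J = F q, K = F r & [fset a; b; c] = [fset p; q; r]].
Proof.
move=> E [IJ IK JK].
have mem x : x \in [fset I; J; K] -> exists2 z, z \in [:: a; b; c] & x = F z.
  rewrite E !inE => /orP[/orP[]|] /eqP ->; [exists a|exists b|exists c] => //;
    by rewrite !inE eqxx ?orbT.
have [|p pO Ip] := mem I; first by rewrite !inE eqxx.
have [|q qO Jq] := mem J; first by rewrite !inE eqxx orbT.
have [|r rO Kr] := mem K; first by rewrite !inE eqxx orbT.
exists p, q, r; split=> //.
move: IJ IK JK pO qO rO; rewrite Ip Jq Kr !inE => IJ IK JK.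
move=> /or3P[]/eqP pE /or3P[]/eqP qE /or3P[]/eqP rE; subst p q r;
  rewrite ?eqxx// in IJ IK JK; apply/fsetP => x; rewrite !inE;
  by do !case: eqP.
Qed.

Lemma fset3D1 (a b c : T) : a != c -> b != c -> [fset a; b; c] `\ c = [fset a; b].
Proof.
move=> ac bc; apply/fsetP => x; rewrite !inE; case: (eqVneq x c) => [->|_].
  by rewrite eq_sym (negbTE ac) eq_sym (negbTE bc).
by rewrite orbF.
Qed.

Lemma fset3C12 (a b c : T) : [fset a; b; c] = [fset b; a; c].
Proof. by apply/fsetP => x; rewrite !inE [(x == a) || _]orbC. Qed.

Lemma fset3C23 (a b c : T) : [fset a; b; c] = [fset a; c; b].
Proof. by apply/fsetP => x; rewrite !inE orbAC. Qed.

(** Lying in the intersection means lying in every member of the set of labels, whatever their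
    order. As colours are defined through some listing of the labels, they can thus be read off any
    listing. *)
Lemma fset3_cap (I J K I' J' K' : {fset T}) :
  [fset I; J; K] = [fset I'; J'; K'] -> I `&` J `&` K = I' `&` J' `&` K'.
Proof.
have capE (L M N : {fset T}) x :
    x \in L `&` M `&` N <-> forall P, P \in [fset L; M; N] -> x \in P.
  rewrite !inE; split=> [/andP[/andP[xL xM] xN] P|h].
    by rewrite !inE => /orP[/orP[]|] /eqP ->.
  by rewrite !h ?inE ?eqxx ?orbT.
by move=> E; apply/fsetP => x; apply/idP/idP => /capE h; apply/capE;
  [rewrite -E|rewrite E].
Qed.
End Triples.

(** * An edge of a Delaunay triangle and the circle of that triangle *)

Section Edges.
Variable R : realType.
Implicit Types (A I J K X : {fset plane R}) (a b c p q r o x : plane R) (s : R).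

Lemma angleC p a b : angle p a b = angle p b a :> R.
Proof. by rewrite /angle dotC [X in _ / X]mulrC. Qed.

Lemma black_cap k I J K : black k [fset I; J; K] -> (#|` I `&` J `&` K| + 2 = k)%N.
Proof. by move=> [I' [J' [K' [/fset3_cap -> ]]]]. Qed.

Lemma white_cap k I J K : white k [fset I; J; K] -> (#|` I `&` J `&` K| + 1 = k)%N.
Proof. by move=> [I' [J' [K' [/fset3_cap -> ]]]]. Qed.

(** Equal labels would have equal averages and make the realized triangle collinear. *)
Lemma delaunay_distinct A k I J K : generic A -> (0 < k)%N ->
  delaunay_triangles A k [fset I; J; K] -> [/\ I != J, I != K & J != K].
Proof.
move=> gA k0 /(delaunay_noncollinear gA k0) nc.
have [h1 h2 h3] := collinear3 nc (realize3 I J K).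
by split; [apply: contra h1|apply: contra h2|apply: contra h3] => /eqP ->.
Qed.

Lemma det3_noncollinear a b c : ~ collinear [fset a; b; c] -> det3 c a b != 0.
Proof.
move=> nc; have [ab ac bc] := collinear3 nc erefl.
apply/eqP => D0; apply: nc; rewrite (_ : [fset a; b; c] = [fset c; a; b]).
  by apply: det3_collinear D0; rewrite eq_sym.
by apply/fsetP => x; rewrite !inE; do !case: eqP.
Qed.

Lemma bary_diff I K p r k : #|` I| = k -> #|` K| = k ->
  \sum_(x <- I) x - \sum_(x <- K) x = p - r ->
  bary I - bary K = k%:R^-1 *: (p - r).
Proof. by move=> cI cK <-; rewrite /bary cI cK scalerBr. Qed.

(** In the white case the labels are Xp, Xq, Xr and the first two meet in X; in the black case they
    are Xpr, Xqr, Xpq and the first two meet in Xr. So in both cases [I] and [J] meet, apart from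
    [r], exactly in the points inside the circle. *)
Lemma delaunay_edge_data A k I J K : generic A -> (0 < k)%N ->
  delaunay_triangles A k [fset I; J; K] ->
  exists p q r o s,
  [/\ [/\ p \in A, q \in A, r \in A & det3 r p q != 0],
      forall x, x \in A -> (pw o s x == 0) = (x \in [fset p; q; r]),
      forall x, x \in A -> x != r -> (x \in I `&` J) = (pw o s x < 0),
      [/\ I `\` J = [fset p], J `\` I = [fset q] &
          opposite_angle I J K = angle r p q] &
      (white k [fset I; J; K] -> r \notin I `&` J /\ K = r |` (I `&` J)) /\
      (black k [fset I; J; K] -> r \in I `&` J /\ K = (I `|` J) `\ r)].
Proof.
move=> gA k0 dt.
have IJK := delaunay_distinct gA k0 dt.
have [a [b [c [ o [s [X [[aA bA cA] [ab ac bc D0] XE OE tE]]]]]]] := delaunayP gA dt.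
have kn : k%:R^-1 != 0 :> R by rewrite invr_eq0 pnatr_eq0 -lt0n.
have nc : ~ collinear [fset a; b; c].
  move=> h; move/eqP: D0; apply; apply: (collinear_det3 h); by rewrite !inE eqxx ?orbT.
have OA x : x \in [fset a; b; c] -> x \in A.
  by rewrite !inE => /orP[/orP[]|] /eqP ->.
have inX x : x \in A -> (x \in X) = (pw o s x < 0) by move=> xA; rewrite XE !inE xA.
have OX x : x \in [fset a; b; c] -> x \notin X.
  by move=> xO; have xA := OA x xO; move: xO; rewrite -OE// inX// => /eqP ->; rewrite ltxx.
clear aA bA cA ab ac bc D0.
case: tE => -[kE tE].
(* A black label is indexed by the circle point that it omits. Thus [I] omits [q] and [J] omits [p],
   which is why these two names come in swapped order below. *)
- pose F x := X `|` ([fset a; b; c] `\ x).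
  have [ab ac bc] := collinear3 nc erefl.
  have FE : [fset I; J; K] = [fset F a; F b; F c].
    have Fa : F a = X `|` [fset b; c] by rewrite /F fset3C12 fset3C23 fset3D1// eq_sym.
    have Fb : F b = X `|` [fset a; c] by rewrite /F fset3C23 fset3D1// eq_sym.
    have Fc : F c = X `|` [fset a; b] by rewrite /F fset3D1.
    by rewrite tE Fa Fb Fc [RHS]fset3C12 [RHS]fset3C23 [RHS]fset3C12.
  have [q [p [r [IE JE KE E]]]] := fset3_image FE IJK.
  rewrite [RHS]fset3C12 in E; rewrite /F E in IE JE KE.
  rewrite E in nc OA OX OE; have D0 := det3_noncollinear nc.
  have [pq pr qr] := collinear3 nc erefl.
  have pO : p \in [fset p; q; r] by rewrite !inE eqxx.
  have qO : q \in [fset p; q; r] by rewrite !inE eqxx orbT.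
  have rO : r \in [fset p; q; r] by rewrite !inE eqxx orbT.
  have [pX qX rX] := And3 (OX _ pO) (OX _ qO) (OX _ rO).
  rewrite [_ `\ q](_ : _ = [fset p; r]) in IE; last first.
    by rewrite fset3C23 fset3D1// eq_sym.
  rewrite [_ `\ p](_ : _ = [fset q; r]) in JE; last first.
    by rewrite fset3C12 fset3C23 fset3D1// eq_sym.
  rewrite fset3D1// in KE.
  have IJX : I `&` J = X `|` [fset r].
    apply/fsetP => x; rewrite IE JE !inE; case: (x \in X) => //=.
    case: (eqVneq x p) => [->|_] /=; first by rewrite (negbTE pq).
    by case: (x == r); rewrite ?orbT ?andbF.
  exists p, q, r, o, s; split=> //.
  + by split=> //; apply: OA.
  + by move=> x xA xr; rewrite IJX !inE (negbTE xr) orbF inX.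
  + split.
    * apply/fsetP => x; rewrite IE JE !inE.
      case: (eqVneq x p) => [->|_]; first by rewrite (negbTE pX) (negbTE pq) (negbTE pr).
      by case: (x \in X) => //=; case: (x == r); rewrite ?orbT ?andbF.
    * apply/fsetP => x; rewrite IE JE !inE.
      case: (eqVneq x q) => [->|_].
        by rewrite (negbTE qX) (negbTE qr) eq_sym (negbTE pq).
      by case: (x \in X) => //=; case: (x == r); rewrite ?orbT ?andbF.
    (* The sums over [J] and [K] differ by [r - p], and those over [I] and [K] by [r - q]: the ratio
       is negative, and [p] corresponds to the vertex of [J]. *)
    * rewrite /opposite_angle angleC; apply: (@angle_homothety _ (- k%:R^-1)).
      - by rewrite oppr_eq0.
      - rewrite scaleNr -scalerN opprB; apply: bary_diff; rewrite ?JE ?KE ?card_U2 ?sum_U2//.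
        by rewrite [_ + p + q]addrAC opprD addrACA subrr add0r.
      - rewrite scaleNr -scalerN opprB; apply: bary_diff; rewrite ?IE ?KE ?card_U2 ?sum_U2//.
        by rewrite opprD addrACA subrr add0r.
  + have IJKX : I `&` J `&` K = X.
      apply/fsetP => x; rewrite IJX KE !inE.
      case: (eqVneq x r) => [->|_]; first by rewrite (negbTE rX) !(eq_sym r) (negbTE pr) (negbTE qr).
      by case: (x \in X).
    (* The triple intersection [X] has [k - 2] elements, which rules out white. *)
    split=> [/white_cap|_]; first by rewrite IJKX -kE => /addnI.
    split; first by rewrite IJX !inE eqxx orbT.
    apply/fsetP => x; rewrite IE JE KE !inE.
    case: (eqVneq x r) => [->|_]; first by rewrite (negbTE rX) !(eq_sym r) (negbTE pr) (negbTE qr).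
    by rewrite !orbF; case: (x \in X).
- have [p [q [r [IE JE KE E]]]] := @fset3_image _ _ (fun x => X `|` [fset x]) a b c I J K tE IJK.
  rewrite E in nc OA OX OE; have D0 := det3_noncollinear nc.
  have [pq pr qr] := collinear3 nc erefl.
  have pO : p \in [fset p; q; r] by rewrite !inE eqxx.
  have qO : q \in [fset p; q; r] by rewrite !inE eqxx orbT.
  have rO : r \in [fset p; q; r] by rewrite !inE eqxx orbT.
  have [pX qX rX] := And3 (OX _ pO) (OX _ qO) (OX _ rO).
  have IJX : I `&` J = X.
    apply/fsetP => x; rewrite IE JE !inE; case: (x \in X) => //=.
    by case: eqP => // ->; rewrite (negbTE pq).
  exists p, q, r, o, s; split=> //.
  + by split=> //; apply: OA.
  + by move=> x xA _; rewrite IJX inX.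
  + split.
    * apply/fsetP => x; rewrite IE JE !inE.
      case: (eqVneq x p) => [->|_]; first by rewrite (negbTE pX) (negbTE pq) orbT.
      by rewrite orbF; case: (x \in X); rewrite ?andbF.
    * apply/fsetP => x; rewrite IE JE !inE.
      case: (eqVneq x q) => [->|_]; first by rewrite (negbTE qX) eq_sym (negbTE pq) orbT.
      by rewrite orbF; case: (x \in X); rewrite ?andbF.
    * rewrite /opposite_angle; apply: (angle_homothety kn).
        by apply: bary_diff; rewrite ?IE ?KE ?card_U1 ?sum_U1// opprD addrACA subrr add0r.
      by apply: bary_diff; rewrite ?JE ?KE ?card_U1 ?sum_U1// opprD addrACA subrr add0r.
  + split=> [_|/black_cap]; first by rewrite IJX KE fsetUC.
    by rewrite (fsetIidPl _) IJX ?KE ?fsubsetUl// -kE => /addnI.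
Qed.
End Edges.

(** * Two circles through the common chord from [p] to [q] *)

Section Chords.
Variables (R : realType) (p q r r' o o' : plane R) (s s' : R).
Hypotheses (D0 : det3 r p q != 0) (D0' : det3 r' p q != 0).
Hypotheses (op : pw o s p = 0) (oq : pw o s q = 0) (o_r : pw o s r = 0).
Hypotheses (op' : pw o' s' p = 0) (oq' : pw o' s' q = 0) (o_r' : pw o' s' r' = 0).

(** The right-hand side of [pw_interp] changes sign when [r] and [r'] are exchanged. Hence nonzero
    powers have equal signs exactly when [r] and [r'] are on opposite sides of the chord. *)
Lemma pw_swap : det3 r p q * pw o s r' = - (det3 r' p q * pw o' s' r).
Proof. by rewrite (pw_interp r' op oq o_r) (pw_interp r op' oq' o_r') opprB. Qed.

(** By [pw_swap] the determinants have opposite signs, so [pw_interp] makes the sum of the two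
    cotangents positive. In [chord_inside] the powers, and with them this sum, are negative. *)
Lemma chord_outside : 0 < pw o s r' -> 0 < pw o' s' r ->
  angle r p q + angle r' p q < pi.
Proof.
move=> h h'; apply: angle_sum_ltpi => //.
have := pw_swap; have := pw_interp r' op oq o_r; have := pw_interp r op' oq' o_r'.
move: D0 D0'; rewrite !neq_lt => /orP[d|d] /orP[d'|d'];
  rewrite ?(ltr0_norm d) ?(gtr0_norm d) ?(ltr0_norm d') ?(gtr0_norm d') => e' e sw; nra.
Qed.

Lemma chord_inside : pw o s r' < 0 -> pw o' s' r < 0 ->
  pi < angle r p q + angle r' p q.
Proof.
move=> h h'; apply: angle_sum_gtpi => //.
have := pw_swap; have := pw_interp r' op oq o_r; have := pw_interp r op' oq' o_r'.
move: D0 D0'; rewrite !neq_lt => /orP[d|d] /orP[d'|d'];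
  rewrite ?(ltr0_norm d) ?(gtr0_norm d) ?(ltr0_norm d') ?(gtr0_norm d') => e' e sw; nra.
Qed.

(** Powers of different signs put [r] and [r'] on the same side of the chord, where [pw_interp]
    makes the cotangent at [r'] the larger one. *)
Lemma chord_mixed : 0 < pw o s r' -> pw o' s' r < 0 -> angle r' p q < angle r p q.
Proof.
move=> h h'; apply: angle_lt => //.
have := pw_swap; have := pw_interp r' op oq o_r; have := pw_interp r op' oq' o_r'.
move: D0 D0'; rewrite !neq_lt => /orP[d|d] /orP[d'|d'];
  rewrite ?(ltr0_norm d) ?(gtr0_norm d) ?(ltr0_norm d') ?(gtr0_norm d') => e' e sw; nra.
Qed.
End Chords.

(** * Two triangles on a common edge, and the local angle property *)

Lemma shared_edge_data (R : realType) (A : {fset plane R}) k I J K L :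
  generic A -> (0 < k)%N -> shared_edge (delaunay_triangles A k) I J K L ->
  exists p q r r' o o' s s',
  [/\ [/\ det3 r p q != 0, pw o s p = 0, pw o s q = 0 & pw o s r = 0],
      [/\ det3 r' p q != 0, pw o' s' p = 0, pw o' s' q = 0 & pw o' s' r' = 0],
      opposite_angle I J K = angle r p q /\ opposite_angle I J L = angle r' p q &
  [/\ white k [fset I; J; K] -> white k [fset I; J; L] ->
        0 < pw o s r' /\ 0 < pw o' s' r,
      black k [fset I; J; K] -> black k [fset I; J; L] ->
        pw o s r' < 0 /\ pw o' s' r < 0 &
      black k [fset I; J; K] -> white k [fset I; J; L] ->
        0 < pw o s r' /\ pw o' s' r < 0]].
Proof.
move=> gA k0 [_ KL dK dL].
have [p [q [r [ o [s [[pA qA rA D] zE IJE [Ip Jq aK] [wK bK]]]]]]] := delaunay_edge_data gA k0 dK.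
have [p' [q' [r' [ o' [s' [[_ _ rA' D'] zE' IJE' [Ip' Jq' aL] [wL bL]]]]]]] := delaunay_edge_data gA k0 dL.
(* The ends of the chord depend only on the edge, so both circles pass through them. *)
have pp : p' = p by apply/eqP; rewrite -in_fset1 -Ip Ip' in_fset1.
have qq : q' = q by apply/eqP; rewrite -in_fset1 -Jq Jq' in_fset1.
subst p' q'.
have zero (x y z w : plane R) t : (forall v, v \in A -> (pw w t v == 0) = (v \in [fset x; y; z])) ->
    x \in A -> y \in A -> z \in A -> [/\ pw w t x = 0, pw w t y = 0 & pw w t z = 0].
  by move=> h xA yA zA; split; apply/eqP; rewrite h// !inE eqxx ?orbT.
have third (x y : plane R) : det3 x p q != 0 -> y != x -> x \notin [fset p; q; y].
  move=> Dx yx; rewrite !inE !negb_or; apply/andP; split; last by rewrite eq_sym.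
  by apply/andP; split; apply: contraNneq Dx => ->; apply/eqP; rewrite det3E; ring.
(* Each circle meets [A] only in its own three points, so the third point of the other triangle has
   nonzero power, whose sign is read off the intersection of [I] and [J]. *)
have sgn : r != r' -> [/\ pw o s r' != 0, pw o' s' r != 0,
    (r' \in I `&` J) = (pw o s r' < 0) & (r \in I `&` J) = (pw o' s' r < 0)].
  move=> rr; have rr' : r' != r by rewrite eq_sym.
  by split; [rewrite zE// third|rewrite zE'// third|exact: IJE|exact: IJE'].
have [h1 h2 h3] := zero _ _ _ _ _ zE pA qA rA.
have [h1' h2' h3'] := zero _ _ _ _ _ zE' pA qA rA'.
exists p, q, r, r', o, o', s, s'; split=> //; split.
- move=> /wK[rK KE] /wL[rL LE].
  (* For a given colour the edge and the third point determine the third label. *)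
  have /sgn[z z' m m'] : r != r' by apply: contra KL => /eqP rr; rewrite KE LE rr.
  by rewrite !lt_neqAle !leNgt -m -m' rK rL !andbT !(eq_sym 0) z z'.
- move=> /bK[rK KE] /bL[rL LE].
  have /sgn[z z' m m'] : r != r' by apply: contra KL => /eqP rr; rewrite KE LE rr.
  by rewrite -m -m' rK rL.
- move=> /bK[rK KE] /wL[rL LE].
  (* For different colours, only [r] lies in the intersection of [I] and [J]. *)
  have /sgn[z z' m m'] : r != r' by apply: contraNneq rL => <-.
  by rewrite -m' rK lt_neqAle leNgt -m rL eq_sym z.
Qed.

Theorem theorem3p3 (R : realType) (A : {fset 'rV[R]_2}) (gA : generic A)
    (k : nat) (k_ge1 : (1 <= k)%N) (k_le : (k <= #|` A| - 1)%N) :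
  local_angle_property (order_delaunay gA k_ge1).
Proof.
split=> I J K L /(shared_edge_data gA k_ge1)
  [p [q [r [r' [ o [ o' [s [s' [[D e1 e2 e3] [D' e1' e2' e3'] [-> ->] [ww bb bw]]]]]]]]]].
- move=> wK wL; have [h h'] := ww wK wL.
  exact/ltW/(chord_outside D D' e1 e2 e3 e1' e2' e3').
- move=> bK bL; have [h h'] := bb bK bL.
  exact/ltW/(chord_inside D D' e1 e2 e3 e1' e2' e3').
- move=> bK wL; have [h h'] := bw bK wL.
  exact: (chord_mixed D D' e1 e2 e3 e1' e2' e3').
Qed.
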